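(* Let $A$ and $B$ be nonnegative selfadjoint linear relations in a complex Hilbert space $\mathcal H$ and let $\mathcal L$ be a closed subspace of $\mathcal H$. Then $$(A:B)_{\mathcal L}=A_{\mathcal L}:B=A:B_{\mathcal L}=A_{\mathcal L}:B_{\mathcal L}.$$
   Context: A linear relation (l.r.) in $\mathcal H$ is a closed linear subspace $A=\{\{f,f'\}\}$ of $\mathcal H\oplus\mathcal H$; $\operatorname{ran}A$ is the set of second components; $\operatorname{mul}A=\{f':\{0,f'\}\in A\}$; $A^{-1}=\{\{f',f\}:\{f,f'\}\in A\}$. $A$ is selfadjoint if $A=A^*:=\{\{g,g'\}:(f',g)=(f,g')\ \forall\{f,f'\}\in A\}$, nonnegative if $(f',f)\ge0$ for all $\{f,f'\}\in A$. A nonnegative selfadjoint l.r. decomposes as $A=\mathrm{Graph}(A_o)\oplus(\{0\}\oplus\operatorname{mul}A)$ with $A_o$ a nonnegative selfadjoint operator in $\mathcal H\ominus\operatorname{mul}A$. The closed form of $A$ is $A[\varphi]=\|A_o^{1/2}\varphi\|^2$, $\varphi\in\mathcal D[A]=\operatorname{dom}A_o^{1/2}$; this gives a bijection between nonnegative selfadjoint l.r. and closed nonnegative (not necessarily densely defined) forms. The order $A_1\ge A_2$ means $\mathcal D[A_1]\subseteq\mathcal D[A_2]$ and $A_1[\varphi]\ge A_2[\varphi]$ for all $\varphi\in\mathcal D[A_1]$. The form sum $A\dot+B$ is the nonnegative selfadjoint l.r. associated with the closed form $A[\varphi]+B[\varphi]$, $\varphi\in\mathcal D[A]\cap\mathcal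 D[B]$. The parallel sum is $A:B:=(A^{-1}\dot+B^{-1})^{-1}$. For a closed subspace $\mathcal L$, $A_{\mathcal L}$ denotes the (existing, unique) maximal element of the set of nonnegative selfadjoint l.r. $\widetilde A$ in $\mathcal H$ with $\widetilde A\le A$ and $\operatorname{ran}\widetilde A\subseteq\mathcal L$. *)

(* Defs.v *)
From HB Require Import structures.
From mathcomp Require Import all_boot all_order all_algebra.
From mathcomp Require Export complex.
From mathcomp Require Import all_classical all_reals all_analysis.

Set Implicit Arguments.
Unset Strict Implicit.
Unset Printing Implicit Defensive.

Import Order.TTheory GRing.Theory Num.Theory numFieldNormedType.Exports.

Local Open Scope classical_set_scope.
Local Open Scope ring_scope.

(* A Hilbert space is a complete normed module over [R[i]] with an inner product
   inducing its norm.  Inner products are linear in the first argument. *)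
Notation inner_product H := {dot H for Num.conj}.

Definition induces_norm (R : realType) (H : completeNormedModType R[i])
  (ip : inner_product H) : Prop := forall x : H, ip x x = `|x| ^+ 2.

Definition closed_subspace (R : realType) (V : normedModType R[i])
  (E : set V) : Prop := submod_closed [in E] /\ closed E.

Section LinearRelations.
Variables (R : realType) (H : completeNormedModType R[i]).
Variable ip : inner_product H.

(* Relations are identified with their graphs, i.e. subsets of [H * H]; the
   product norm topology is that of the Hilbert sum. *)
Implicit Types (A B S : set (H * H)) (K L D : set H) (q : H -> R[i]).

Definition lr_dom A : set H := [set f | exists f', A (f, f')].

Definition lr_ran A : set H := [set f' | exists f, A (f, f')].

Definition lr_mul A : set H := [set f' | A (0, f')].

Definition lr_inverse A : set (H * H) := [set p | A (p.2, p.1)].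

Definition lr_compose A B : set (H * H) :=
  [set p | exists2 g, B (p.1, g) & A (g, p.2)].

Definition lr_adjoint A : set (H * H) :=
  [set g | forall f, A f -> ip f.2 g.1 = ip f.1 g.2].

Definition lr_nonnegative A : Prop := forall f, A f -> 0 <= ip f.2 f.1.

Definition nonneg_selfadjoint A : Prop :=
  [/\ closed_subspace A, lr_adjoint A = A & lr_nonnegative A].

Definition orthocompl K : set H := [set x | forall y, K y -> ip x y = 0].

Definition operator_part A : set (H * H) :=
  [set p | A p /\ orthocompl (lr_mul A) p.2].

(* Operators acting in the Hilbert space [K], a closed subspace of [H]: the
   adjoint is the one taken in [K]. *)
Definition nonneg_selfadjoint_operator_in K S : Prop :=
  [/\ closed_subspace S, S `<=` K `*` K, lr_mul S = [set 0],
      lr_adjoint S `&` (K `*` K) = S & lr_nonnegative S].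

Definition is_sqrt_operator_part A S : Prop :=
  nonneg_selfadjoint_operator_in (orthocompl (lr_mul A)) S /\
  lr_compose S S = operator_part A.

(* The definite descriptions below are rendered with [xget]; its default value
   is irrelevant whenever the described object exists. *)
Definition sqrt_operator_part A : set (H * H) :=
  xget set0 [set S | is_sqrt_operator_part A S].

Definition apply_operator S (f : H) : H := xget 0 [set f' | S (f, f')].

Definition closed_form_dom A : set H := lr_dom (sqrt_operator_part A).

Definition closed_form A (f : H) : R[i] :=
  `|apply_operator (sqrt_operator_part A) f| ^+ 2.

Definition closed_form_le A B : Prop :=
  closed_form_dom B `<=` closed_form_dom A /\
  forall f, closed_form_dom B f -> closed_form A f <= closed_form B f.

(* The nonnegative selfadjoint relation whose closed form is [q] on [D]. *)
Definition relation_of_form D q : set (H * H) :=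
  xget set0 [set C | [/\ nonneg_selfadjoint C, closed_form_dom C = D &
                         forall f, D f -> closed_form C f = q f]].

Definition form_sum A B : set (H * H) :=
  relation_of_form (closed_form_dom A `&` closed_form_dom B)
    (fun f => closed_form A f + closed_form B f).

Definition parallel_sum A B : set (H * H) :=
  lr_inverse (form_sum (lr_inverse A) (lr_inverse B)).

Definition shorted_candidate A L : set (set (H * H)) :=
  [set X | [/\ nonneg_selfadjoint X, closed_form_le X A & lr_ran X `<=` L]].

Definition shorted A L : set (H * H) :=
  xget set0 [set M | shorted_candidate A L M /\
    forall X, shorted_candidate A L X -> closed_form_le M X -> X = M].

End LinearRelations.

(* Main.v *)
(* On nonnegative selfadjoint relations the closed form can be written without
   square roots, as [A[f] = sup { 2 Re (f, p') - (p', p) : {p, p'} in A }].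
   Approximating [f] by the resolvents [(1 + e A)^-1 f] shows that the form
   determines the relation and that [A |-> A^-1] reverses the order.  Hence
   [(A_L)^-1] is the relation of the smallest form above that of [A^-1] with domain
   in [L], i.e. the form sum of [A^-1] and [N = L x L^perp], whose form is [0] on
   [L]; thus [A_L = A : N^-1].  Since form sums are associative and commutative and
   [N] is idempotent, all four relations coincide.
   The form sum itself exists because [T^* T] is nonnegative selfadjoint with form
   [|T f|^2] for every closed linear [T]; the square root of [A] comes from
   [A = {{B x, (1 - B) x}}], [B = (1 + A)^-1], as
   [{{B^(1/2) x, (1 - B)^(1/2) x}}] restricted to the complement of [mul A]. *)

Require Import Defs.
From mathcomp Require Import all_boot all_order all_algebra.
From mathcomp Require Import all_classical all_reals all_analysis.
From mathcomp Require Import ring lra.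

Set Implicit Arguments.
Unset Strict Implicit.
Unset Printing Implicit Defensive.

Import Order.TTheory GRing.Theory Num.Theory numFieldNormedType.Exports.

Local Open Scope classical_set_scope.
Local Open Scope ring_scope.

(** * Semi-inner products and orthogonal projection *)

(** The discriminant inequality, with no sign assumed on [c]: a negative [c] is refuted by a large
    [t], a positive one is handled at the minimizer [- p / c], and [c = 0] forces [p = 0]. *)
Lemma quad_ge0 (R : realType) (a p c : R) :
  (forall t, 0 <= a + 2 * t * p + t ^+ 2 * c) -> p ^+ 2 <= a * c.
Proof.
move=> h; have [c0|c0|c0] := ltrgtP c 0.
- have a0 : 0 <= a by have := h 0; rewrite mulr0 mul0r expr0n mul0r !addr0.
  (* Chosen so that [t * - c] exceeds [2 * |p| + a] while [1 <= t]; the quadratic is then negative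
     at [t]. *)
  pose t := (2 * `|p| + a + 1) / - c + 1.
  have t1 : 1 <= t.
    by rewrite lerDr divr_ge0 ?oppr_ge0 ?(ltW c0)// addr_ge0// addr_ge0// mulr_ge0.
  have tc : t * (- c) = 2 * `|p| + a + 1 - c.
    by rewrite mulrDl mul1r divfK// oppr_eq0 lt_eqF.
  have := h t.
  have -> : t ^+ 2 * c = - (t * (t * - c)) by ring.
  rewrite tc; have := ler_norm p => pp.
  have : t * p <= t * `|p| by rewrite ler_wpM2l// (le_trans _ t1).
  have : a <= t * a by rewrite ler_peMl.
  have : 0 < t by rewrite (lt_le_trans _ t1).
  have : 0 < - c * t by rewrite mulr_gt0 ?oppr_gt0// (lt_le_trans _ t1).
  by nra.
- have := h (- p / c).
  have -> : a + 2 * (- p / c) * p + (- p / c) ^+ 2 * c = (a * c - p ^+ 2) / c.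
    by field; rewrite gt_eqF.
  by rewrite pmulr_lge0 ?invr_gt0// subr_ge0.
- subst c; rewrite mulr0.
  have [->|p0] := eqVneq p 0; first by rewrite expr0n.
  have := h (- (a + 1) / (2 * p)).
  have -> : a + 2 * (- (a + 1) / (2 * p)) * p + (- (a + 1) / (2 * p)) ^+ 2 * 0
     = -1 by field.
  by lra.
Qed.

(** Stands in for passing to the limit: an error term is bounded by a fixed multiple [K] of an
    arbitrary [e]. *)
Lemma le_of_small (R : realType) (x K : R) :
  (forall e, 0 < e -> x <= K * e) -> x <= 0.
Proof.
move=> h; rewrite leNgt; apply/negP => x0.
have [K0|K0] := lerP K 0.
  by have := h 1 ltr01; lra.
have : 0 < x / (2 * K) by rewrite divr_gt0// mulr_gt0.
move=> /h; have -> : K * (x / (2 * K)) = x / 2 by field; rewrite gt_eqF.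
by lra.
Qed.

Lemma bounded_nondecreasing_cauchy (R : realType) (m : nat -> R) (c : R) :
  (forall i j, (i <= j)%N -> m i <= m j) -> (forall n, m n <= c) ->
  forall e, 0 < e ->
    exists N, forall i j, (N <= i)%N -> (i <= j)%N -> m j - m i < e.
Proof.
move=> mono bnd e e0.
have hs : has_sup (range m).
  by split; [exists (m 0%N), 0%N|exists c => _ [n _ <-]].
have [_ [N _ <-] hN] := sup_adherent e0 hs.
exists N => i j Ni _.
have := mono _ _ Ni.
have : m j <= sup (range m) by apply: ub_le_sup; [case: hs|exists j].
by lra.
Qed.

(* Hilbert space arguments only involve real parts of inner products; invariance
   under ['i] recovers the complex statements. *)
Record hform (R : realType) (V : lmodType R[i]) := HForm {
  hf :> V -> V -> R;
  hfDl : forall u v w, hf (u + v) w = hf u w + hf v w;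
  hfZl : forall (a : R) u v, hf (a%:C%C *: u) v = a * hf u v;
  hfC : forall u v, hf u v = hf v u;
  hf_ge0 : forall u, 0 <= hf u u;
  hfi : forall u v, hf ('i%C *: u) ('i%C *: v) = hf u v }.

Arguments hf {R V} h u v : simpl never, rename.

Section Forms.
Variables (R : realType) (V : lmodType R[i]) (b : hform V).
Implicit Types (u v w : V) (W : set V).

Lemma hfDr u v w : b w (u + v) = b w u + b w v.
Proof. by rewrite hfC hfDl !(hfC b w). Qed.

Lemma hfZr a u v : b u (a%:C%C *: v) = a * b u v.
Proof. by rewrite hfC hfZl hfC. Qed.

Lemma hfNl u v : b (- u) v = - b u v.
Proof.
have -> : - u = (-1)%:C%C *: u by rewrite rmorphN1 scaleN1r.
by rewrite hfZl mulN1r.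
Qed.

Lemma hfNr u v : b u (- v) = - b u v.
Proof. by rewrite hfC hfNl hfC. Qed.

Lemma hf0l v : b 0 v = 0.
Proof. by rewrite -(subrr v) hfDl hfNl subrr. Qed.

Lemma hf0r v : b v 0 = 0.
Proof. by rewrite hfC hf0l. Qed.

Definition hfE := (hfDl, hfDr, hfNl, hfNr, hfZl, hfZr, hf0l, hf0r).

(** Squared distances keep all estimates polynomial; the form is only semidefinite, so distance zero
    need not mean equality. *)
Definition sqd u v : R := b (u - v) (u - v).

Lemma sqd_ge0 u v : 0 <= sqd u v.
Proof. exact: hf_ge0. Qed.

Lemma sqdC u v : sqd u v = sqd v u.
Proof. by rewrite /sqd -opprB hfNl hfNr opprK. Qed.

(** By the parallelogram law the two sides differ by the square of [(u - v) - (v - w)]. *)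
Lemma sqd_tri u v w : sqd u w <= 2 * sqd u v + 2 * sqd v w.
Proof.
have -> : sqd u w = b ((u - v) + (v - w)) ((u - v) + (v - w)).
  by rewrite /sqd addrA subrK.
have := hf_ge0 b ((u - v) - (v - w)).
rewrite /sqd; move: (u - v) (v - w) => x y.
rewrite !hfE (hfC b y x); lra.
Qed.

Lemma cauchy_schwarz u v : b u v ^+ 2 <= b u u * b v v.
Proof.
apply: quad_ge0 => t; have := hf_ge0 b (u + t%:C%C *: v).
by rewrite !hfE (hfC b v u); set x := (X in 0 <= X -> _); suff -> : x =
  b u u + 2 * t * b u v + t ^+ 2 * b v v by []; rewrite /x; ring.
Qed.

Lemma sqd_shift (t : R) u v w :
  sqd u (v + (- t)%:C%C *: w) = sqd u v + 2 * t * b (u - v) w + t ^+ 2 * b w w.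
Proof.
rewrite /sqd opprD addrA rmorphN scaleNr opprK.
by move: (u - v) => x; rewrite !hfE (hfC b w x); ring.
Qed.

Definition cauchy_for (s : nat -> V) := forall e, 0 < e ->
  exists N, forall m n, (N <= m)%N -> (N <= n)%N -> sqd (s m) (s n) < e.

Definition tends_to (s : nat -> V) u := forall e, 0 < e ->
  exists N, forall n, (N <= n)%N -> sqd (s n) u < e.

Definition complete_for W := forall s : nat -> V, (forall n, W (s n)) ->
  cauchy_for s -> exists2 w, W w & tends_to s w.

Definition closed_for W := forall u,
  (forall e, 0 < e -> exists2 w, W w & sqd u w < e) -> W u.

Lemma inv_natS_small (e : R) : 0 < e ->
  exists N, forall n, (N <= n)%N -> n.+1%:R^-1 < e :> R.
Proof.
move=> e0; exists (Num.truncn e^-1).+1 => n hn.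
rewrite -[ltRHS]invrK ltf_pV2 ?posrE ?invr_gt0 ?ltr0Sn//.
apply: lt_le_trans (truncnS_gt _) _; rewrite ler_nat.
exact: leq_trans hn (leqnSn _).
Qed.

(** A minimizing sequence for the distance from [h] is Cauchy by the parallelogram law, and
    minimality in each direction [v] gives orthogonality. Only real linearity and completeness of
    [W] enter. *)
Lemma projection W (h : V) : W 0 -> (forall u v, W u -> W v -> W (u + v)) ->
  (forall a : R, forall u, W u -> W (a%:C%C *: u)) -> complete_for W ->
  exists2 w, W w & forall v, W v -> b (h - w) v = 0.
Proof.
move=> W0 WD WZ cW.
pose E := [set sqd h w | w in W].
have infE : has_inf E.
  by split; [exists (sqd h 0), 0|exists 0 => _ [w _ <-]; exact: sqd_ge0].
pose d := inf E.
have dle w : W w -> d <= sqd h w.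
  by move=> Ww; apply: ge_inf; [case: infE|exists w].
have /choice[s hs] n : exists w, W w /\ sqd h w < d + n.+1%:R^-1.
  have [|_ [w Ww <-] hw] := @inf_adherent _ E n.+1%:R^-1 _ infE.
    by rewrite invr_gt0.
  by exists w.
have Ws n : W (s n) by case: (hs n).
have cs : cauchy_for s.
  move=> e e0; have [N hN] := inv_natS_small (divr_gt0 e0 (ltr0n R 4)).
  exists N => m n /hN hm /hN hn.
  (* The midpoint of two terms lies in [W], so its distance is at least the infimum. *)
  have := dle _ (WZ 2^-1 _ (WD _ _ (Ws m) (Ws n))).
  have := (hs m).2; have := (hs n).2.
  rewrite /sqd !hfE (hfC b (s n) (s m)) (hfC b (s n) h) (hfC b (s m) h).
  move: hm hn; move: (m.+1%:R^-1) (n.+1%:R^-1) => x y.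
  by lra.
have [w Ww sw] := cW s Ws cs.
exists w => // v Wv.
apply/eqP; rewrite -sqrf_eq0 eq_le sqr_ge0 andbT.
apply: (@le_of_small _ _ (4 * b v v)) => e e0.
have [N1 hN1] := inv_natS_small e0.
have [N2 hN2] := sw _ e0.
pose n := maxn N1 N2.
(* Moving from [s n] along [v] lowers the squared distance by at most [n.+1%:R^-1]; the discriminant
   of this quadratic in [t] bounds the inner product. *)
have near1 : b (h - s n) v ^+ 2 <= n.+1%:R^-1 * b v v.
  apply: quad_ge0 => t.
  have := dle _ (WD _ _ (Ws n) (WZ (- t) _ Wv)); have := (hs n).2.
  rewrite sqd_shift; move: (n.+1%:R^-1) => x; lra.
have near2 := cauchy_schwarz (s n - w) v.
have := hN1 n (leq_maxl _ _); have := hN2 n (leq_maxr _ _).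
rewrite -/(sqd _ _) in near2; move: near1 near2.
have -> : h - w = (h - s n) + (s n - w) by rewrite addrA subrK.
rewrite (hfDl b (h - s n)); have := hf_ge0 b v.
set x := b (h - _) v; set y := b (_ - w) v; set z := n.+1%:R^-1 => vv xx yy k1 k2.
have : z * b v v <= e * b v v by rewrite ler_wpM2r// ltW.
have : sqd (s n) w * b v v <= e * b v v by rewrite ler_wpM2r// ltW.
have := sqr_ge0 (x - y); lra.
Qed.

End Forms.

(** * Orthogonal sums and completeness *)

Section ProductForm.
Variables (R : realType) (V1 V2 : lmodType R[i]) (b1 : hform V1) (b2 : hform V2).

Definition prod_hf (u v : V1 * V2) : R := b1 u.1 v.1 + b2 u.2 v.2.

Lemma prod_hfDl u v w : prod_hf (u + v) w = prod_hf u w + prod_hf v w.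
Proof. by rewrite /prod_hf !hfDl; ring. Qed.

Lemma prod_hfZl (a : R) u v : prod_hf (a%:C%C *: u) v = a * prod_hf u v.
Proof. by rewrite /prod_hf !hfZl; ring. Qed.

Lemma prod_hfC u v : prod_hf u v = prod_hf v u.
Proof. by rewrite /prod_hf (hfC b1) (hfC b2). Qed.

Lemma prod_hf_ge0 u : 0 <= prod_hf u u.
Proof. by rewrite addr_ge0// hf_ge0. Qed.

Lemma prod_hfi u v : prod_hf ('i%C *: u) ('i%C *: v) = prod_hf u v.
Proof. by rewrite /prod_hf !hfi. Qed.

Definition prod_hform := HForm prod_hfDl prod_hfZl prod_hfC prod_hf_ge0 prod_hfi.

Lemma sqd_prod u v : sqd prod_hform u v = sqd b1 u.1 v.1 + sqd b2 u.2 v.2.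
Proof. by []. Qed.

Lemma cauchy_for_prod s : cauchy_for prod_hform s ->
  cauchy_for b1 (fun n => (s n).1) /\ cauchy_for b2 (fun n => (s n).2).
Proof.
move=> cs; split=> e e0; have [N hN] := cs e e0; exists N => m n hm hn;
  have := hN m n hm hn; rewrite sqd_prod; apply: le_lt_trans;
  by rewrite ?lerDl ?lerDr sqd_ge0.
Qed.

Lemma tends_to_prod s u1 u2 : tends_to b1 (fun n => (s n).1) u1 ->
  tends_to b2 (fun n => (s n).2) u2 -> tends_to prod_hform s (u1, u2).
Proof.
move=> t1 t2 e e0; have e2 : 0 < e / 2 by rewrite divr_gt0.
have [N1 h1] := t1 _ e2; have [N2 h2] := t2 _ e2.
exists (maxn N1 N2) => n; rewrite geq_max => /andP[/h1 k1 /h2 k2].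
by rewrite sqd_prod; apply: lt_le_trans (ltrD k1 k2) _; rewrite -splitr.
Qed.

Lemma complete_prod : complete_for b1 setT -> complete_for b2 setT ->
  complete_for prod_hform setT.
Proof.
move=> c1 c2 s _ /cauchy_for_prod[s1 s2].
have [u1 _ t1] := c1 _ (fun=> I) s1; have [u2 _ t2] := c2 _ (fun=> I) s2.
by exists (u1, u2) => //; exact: tends_to_prod.
Qed.

End ProductForm.


Lemma closed_complete (R : realType) (V : lmodType R[i]) (b : hform V) W :
  complete_for b setT -> closed_for b W -> complete_for b W.
Proof.
move=> cV cW s Ws cs; have [u _ tu] := cV s (fun=> I) cs.
exists u => //; apply: cW => e e0; have [N hN] := tu e e0.
by exists (s N) => //; rewrite sqdC hN.
Qed.

(** * The topology of a Hilbert space *)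

Section Hilbert.
Variables (R : realType) (H : completeNormedModType R[i]).
Variable ip : inner_product H.

Definition rp (x y : H) : R := complex.Re (ip x y).

Lemma rpDl u v w : rp (u + v) w = rp u w + rp v w.
Proof. by rewrite /rp linearDl -raddfD. Qed.

Lemma rpZl (a : R) u v : rp (a%:C%C *: u) v = a * rp u v.
Proof. by rewrite /rp linearZl /=; case: (ip u v) => x y /=; rewrite mul0r subr0. Qed.

Lemma rpC u v : rp u v = rp v u.
Proof. by rewrite /rp hermC /= mul1r; case: (ip v u). Qed.

Lemma rp_ge0 u : 0 <= rp u u.
Proof. by have := dnorm_ge0 ip u; rewrite lecE => /andP[]. Qed.

(** Conjugate linearity in the second argument turns the imaginary part of [ip u v] into the real
    part of [ip u ('i v)]. *)
Lemma ip_rp u v : ip u v = (rp u v +i* rp u ('i%C *: v))%C.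
Proof.
by rewrite /rp linearZr /=; case: (ip u v) => x y /=; congr (_ +i* _)%C; ring.
Qed.

Lemma rpi u v : rp ('i%C *: u) ('i%C *: v) = rp u v.
Proof.
by rewrite /rp linearZr linearZl /=; case: (ip u v) => x y /=; ring.
Qed.

Definition rform : hform H := HForm rpDl rpZl rpC rp_ge0 rpi.

Lemma rpiC u v : rp ('i%C *: u) v = - rp u ('i%C *: v).
Proof.
by rewrite /rp linearZr linearZl /=; case: (ip u v) => x y /=; ring.
Qed.

Lemma ip_eq u v u' v' :
  rp u v = rp u' v' -> rp u ('i%C *: v) = rp u' ('i%C *: v') -> ip u v = ip u' v'.
Proof. by move=> e1 e2; rewrite !ip_rp e1 e2. Qed.

Lemma rp_eq0 u : rp u u = 0 -> u = 0.
Proof.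
move=> h; apply/eqP; rewrite -(dnorm_eq0 ip) eq_complex /=.
apply/andP; split; first exact/eqP.
by have := dnorm_ge0 ip u; rewrite lecE => /andP[].
Qed.

Hypothesis ip_norm : induces_norm ip.

Lemma ip_sq u : ip u u = (rp u u)%:C%C.
Proof.
by have := dnorm_ge0 ip u; rewrite /rp lecE => /andP[]; case: (ip u u) => x y /= /eqP ->.
Qed.

Lemma norm_sq u : `|u| ^+ 2 = (rp u u)%:C%C.
Proof. by rewrite -ip_norm ip_sq. Qed.

Lemma ball_sqd (x y : H) (e : R) : 0 < e ->
  ball x e%:C%C y <-> sqd rform x y < e ^+ 2.
Proof.
move=> e0; rewrite -ball_normE /ball_ /=.
rewrite -(@ltr_pXn2r _ 2)// ?nnegrE ?normr_ge0 ?ler0c ?ltW//.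
by rewrite norm_sq -rmorphXn ltcR.
Qed.

Lemma hilbert_complete : complete_for rform setT.
Proof.
move=> s _ cs.
have : cauchy (s @ \oo).
  apply/cauchy_ballP => e; rewrite ltcE /= => /andP[/eqP ime ree].
  (* Radii live in [R[i]], where a positive element is necessarily real. *)
  have ee : e = (complex.Re e)%:C%C by case: e ime ree => x y /= ->.
  have [N hN] := cs (complex.Re e ^+ 2) (exprn_gt0 _ ree).
  pose T := [set s n | n in [set n | (N <= n)%N]].
  exists (T, T) => /=; first by split; exists N => // n hn; exists n.
  move=> [_ _] /= [[m hm <-] [n hn <-]]; rewrite ee.
  by apply/ball_sqd => //; exact: hN.
move=> /cauchy_cvg /cvg_ex[l /cvg_ballP sl]; exists l => // e e0.
have se0 : 0 < Num.sqrt e by rewrite sqrtr_gt0.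
have [|N _ hN] := sl (Num.sqrt e)%:C%C; first by rewrite ltcR.
exists N => n /hN /= /(ball_sqd _ _ se0).
by rewrite sqr_sqrtr ?ltW// sqdC.
Qed.

Lemma nbhs_sqd (x : H) (B : set H) :
  nbhs x B <-> exists2 e, 0 < e & forall y, sqd rform x y < e -> B y.
Proof.
rewrite -nbhs_ballE; split=> [[e /= + hB]|[e e0 hB]].
  rewrite ltcE /= => /andP[/eqP ime ree].
  have ee : e = (complex.Re e)%:C%C by case: e ime ree {hB} => x' y /= ->.
  exists (complex.Re e ^+ 2); first exact: exprn_gt0.
  by move=> y /ball_sqd => /(_ ree); rewrite -ee => /hB.
have se0 : 0 < Num.sqrt e by rewrite sqrtr_gt0.
exists (Num.sqrt e)%:C%C; first by rewrite /= ltcR.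
by move=> y /(ball_sqd _ _ se0); rewrite sqr_sqrtr ?ltW//; exact: hB.
Qed.

Lemma closed_sqd (W : set H) : closed W <-> closed_for rform W.
Proof.
split=> [cW u hu|cW u hu].
  apply: cW => B /nbhs_sqd[e e0 hB]; have [w Ww uw] := hu e e0.
  by exists w; split => //; exact: hB.
apply: cW => e e0.
have [|w [Ww uw]] := hu [set y | sqd rform u y < e]; first by apply/nbhs_sqd; exists e.
by exists w.
Qed.

Lemma closed_sqd2 (W : set (H * H)) :
  closed W <-> closed_for (prod_hform rform rform) W.
Proof.
split=> [cW u hu|cW u hu].
  apply: cW => B [[B1 B2]] /= [/nbhs_sqd[e1 e10 h1] /nbhs_sqd[e2 e20 h2]] hB.
  have e0 : 0 < Num.min e1 e2 by rewrite lt_min e10.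
  have [w Ww] := hu _ e0; rewrite sqd_prod lt_min => /andP[w1 w2].
  exists w; split => //; apply: hB; split => /=.
  - by apply: h1; apply: le_lt_trans w1; rewrite lerDl sqd_ge0.
  - by apply: h2; apply: le_lt_trans w2; rewrite lerDr sqd_ge0.
apply: cW => e e0; have e20 : 0 < e / 2 by rewrite divr_gt0.
have [|w [Ww [w1 w2]]] := hu [set y | sqd rform u.1 y.1 < e / 2 /\
    sqd rform u.2 y.2 < e / 2].
  exists ([set y | sqd rform u.1 y < e / 2], [set y | sqd rform u.2 y < e / 2]) => //.
  by split; apply/nbhs_sqd; exists (e / 2).
exists w => //; rewrite [ltRHS](splitr e).
by change (sqd rform u.1 w.1 + sqd rform u.2 w.2 < e / 2 + e / 2); exact: ltrD.
Qed.

End Hilbert.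

(** * Linear subspaces given as sets *)

Lemma submod_closedE (K : nzRingType) (V : lmodType K) (E : set V) :
  submod_closed [in E] <->
  E 0 /\ forall a u v, E u -> E v -> E (a *: u + v).
Proof.
split=> [[h0 hD]|[h0 hD]]; split.
- by move: h0; rewrite !inE.
- by move=> a u v Eu Ev; have := hD a u v; rewrite !inE; exact.
- by rewrite !inE.
- by move=> a u v; rewrite !inE; exact: hD.
Qed.

Lemma submodD (K : nzRingType) (V : lmodType K) (E : set V) :
  submod_closed [in E] -> forall u v, E u -> E v -> E (u + v).
Proof.
by move=> /submod_closedE[_ hE] u v Eu Ev; rewrite -(scale1r u); exact: hE.
Qed.

Lemma submodZ (K : nzRingType) (V : lmodType K) (E : set V) :
  submod_closed [in E] -> forall a u, E u -> E (a *: u).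
Proof.
by move=> /submod_closedE[E0 hE] a u Eu; rewrite -(addr0 (_ *: _)); exact: hE.
Qed.

Lemma submodB (K : nzRingType) (V : lmodType K) (E : set V) :
  submod_closed [in E] -> forall u v, E u -> E v -> E (u - v).
Proof.
by move=> sE u v Eu Ev; rewrite -scaleN1r; apply: submodD => //; exact: submodZ.
Qed.

(** * Nonnegative selfadjoint relations and their resolvents *)

Lemma tends_to_cauchy (R : realType) (V : lmodType R[i]) (b : hform V) s u :
  tends_to b s u -> cauchy_for b s.
Proof.
move=> su e e0; have e4 : 0 < e / 4 by rewrite divr_gt0.
have [N hN] := su _ e4; exists N => m n /hN hm /hN hn.
by have := sqd_tri b (s m) u (s n); rewrite (sqdC _ u); lra.
Qed.

Lemma tends_to_unique (R : realType) (V : lmodType R[i]) (b : hform V) s u v :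
  tends_to b s u -> tends_to b s v -> sqd b u v = 0.
Proof.
move=> su sv; apply/eqP; rewrite eq_le sqd_ge0 andbT.
apply: (@le_of_small _ _ 4) => e e0.
have [N hN] := su _ e0; have [M hM] := sv _ e0.
have := hN _ (leq_maxl N M); have := hM _ (leq_maxr N M).
by have := sqd_tri b u (s (maxn N M)) v; rewrite (sqdC _ u (s _)); lra.
Qed.

Lemma tends_to_bound (R : realType) (V : lmodType R[i]) (b : hform V) s u c :
  tends_to b s u -> (forall n, b (s n) (s n) <= c) -> b u u <= c.
Proof.
move=> su sc; rewrite -subr_le0; apply: (@le_of_small _ _ (c + 1)) => e e0.
have [|N /(_ N (leqnn _)) hN] := su (e ^+ 2 / (1 + e)).
  by rewrite divr_gt0 ?exprn_gt0// addr_gt0.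
have xc := sc N; move: hN; rewrite sqdC /sqd ltr_pdivlMr ?addr_gt0//.
have uE : u = s N + (u - s N) by rewrite addrC subrK.
rewrite [X in b X X - c]uE; move: (s N) (u - s N) xc => x y xc h1.
have h2 := hf_ge0 b (e%:C%C *: x - y).
have h3 : 0 <= e * (c - b x x) by rewrite mulr_ge0 ?subr_ge0// ltW.
have h4 : 0 <= e ^+ 2 * (c - b x x) by rewrite mulr_ge0 ?subr_ge0// sqr_ge0.
by rewrite -(ler_pM2l e0); move: h2; rewrite !hfE (hfC b y x); lra.
Qed.

Section NonnegSelfadjoint.
Variables (R : realType) (H : completeNormedModType R[i]).
Variable ip : inner_product H.
Hypothesis ip_norm : induces_norm ip.
Implicit Types (A : set (H * H)) (p q : H * H).

Local Notation rr := (hf (rform ip)).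
Local Notation sq2 := (prod_hform (rform ip) (rform ip)).

Lemma rr_iC u v : rr ('i%C *: u) v = - rr u ('i%C *: v).
Proof. exact: rpiC. Qed.

(** Testing against ['i *: p] along with [p] recovers the imaginary part, so real parts suffice for
    linear [A]. *)
Lemma adjoint_rr A q : submod_closed [in A] ->
  lr_adjoint ip A q <-> forall p, A p -> rr p.2 q.1 = rr p.1 q.2.
Proof.
move=> sA; split=> [hq p Ap|hq p Ap].
  by have := hq _ Ap; rewrite /hf /= /rp => ->.
apply: ip_eq; first exact: hq.
by apply: oppr_inj; rewrite -!rpiC; exact: (hq _ (submodZ sA 'i%C Ap)).
Qed.

Lemma adjoint_closed A : submod_closed [in A] -> closed_for sq2 (lr_adjoint ip A).
Proof.
move=> sA q hq; apply/adjoint_rr => // p Ap.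
apply/eqP; rewrite -subr_eq0 -sqrf_eq0 eq_le sqr_ge0 andbT.
(* The defect of [q] equals that of [q - w] for [w] in the adjoint; Cauchy-Schwarz on its two terms
   yields this constant. *)
apply: (@le_of_small _ _ (2 * rr p.2 p.2 + 2 * rr p.1 p.1)) => e e0.
have [w /(adjoint_rr _ sA)/(_ _ Ap) hw] := hq _ e0; rewrite sqd_prod => qw.
have -> : rr p.2 q.1 - rr p.1 q.2 = rr p.2 (q.1 - w.1) - rr p.1 (q.2 - w.2).
  by rewrite !hfE hw; ring.
have := cauchy_schwarz (rform ip) p.2 (q.1 - w.1).
have := cauchy_schwarz (rform ip) p.1 (q.2 - w.2).
move: qw; rewrite /sqd; have := hf_ge0 (rform ip) p.1; have := hf_ge0 (rform ip) p.2.
have := hf_ge0 (rform ip) (q.1 - w.1); have := hf_ge0 (rform ip) (q.2 - w.2).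
set x := rr p.2 p.2; set y := rr p.1 p.1; set z := rr p.2 _; set t := rr p.1 _.
set d1 := rr (q.1 - _) _; set d2 := rr (q.2 - _) _ => d20 d10 x0 y0 de h1 h2.
have := sqr_ge0 (z + t).
have : y * d2 <= y * e by rewrite ler_wpM2l//; lra.
have : x * d1 <= x * e by rewrite ler_wpM2l//; lra.
by nra.
Qed.

Section Facts.
Variable A : set (H * H).
Hypothesis nsaA : nonneg_selfadjoint ip A.

Lemma nsa_submod : submod_closed [in A].
Proof. by case: nsaA => [[]]. Qed.

Lemma nsa_closed : closed_for sq2 A.
Proof. by case: nsaA => [[_ /(closed_sqd2 ip_norm)]]. Qed.

Lemma nsa_sym p q : A p -> A q -> rr p.2 q.1 = rr p.1 q.2.
Proof.
move=> Ap; case: (nsaA) => _ e _; rewrite -{1}e => /(adjoint_rr _ nsa_submod).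
exact.
Qed.

Lemma nsa_mem q : (forall p, A p -> rr p.2 q.1 = rr p.1 q.2) -> A q.
Proof.
by move=> hq; case: (nsaA) => _ <- _; apply/(adjoint_rr _ nsa_submod).
Qed.

Lemma nsa_ge0 p : A p -> 0 <= rr p.2 p.1.
Proof. by case: (nsaA) => _ _ h /h; rewrite lecE => /andP[]. Qed.

(** Surjectivity of [1 + e A]: nonnegativity bounds this map from below, so its range is complete,
    and a vector [k] orthogonal to the range gives [{e k, - k}] in the adjoint, hence in [A], which
    forces [k = 0]. *)
Lemma nsa_range (e : R) h : 0 < e ->
  exists2 p, A p & p.1 + e%:C%C *: p.2 = h.
Proof.
move=> e0; have sA := nsa_submod.
pose W := [set p.1 + e%:C%C *: p.2 | p in A].
have low p : A p -> rr p.1 p.1 + e ^+ 2 * rr p.2 p.2 <=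
    rr (p.1 + e%:C%C *: p.2) (p.1 + e%:C%C *: p.2).
  move=> /nsa_ge0 h0; rewrite !hfE (hfC _ p.1 p.2).
  by have := mulr_ge0 (ltW e0) h0; lra.
have diff p q : (p.1 + e%:C%C *: p.2) - (q.1 + e%:C%C *: q.2) =
    (p - q).1 + e%:C%C *: (p - q).2.
  by rewrite /= scalerBr opprD addrACA.
have cW : complete_for (rform ip) W.
  move=> s /= /(_ _)/cid2; move=> hs cs.
  pose r n := s2val (hs n).
  have Ar n : A (r n) by rewrite /r; case: (hs n).
  have rs n : s n = (r n).1 + e%:C%C *: (r n).2 by rewrite /r; case: (hs n).
  have [||p Ap rp] := @closed_complete _ _ sq2 A _ nsa_closed r Ar.
  - by apply: complete_prod; exact: hilbert_complete.
  (* The factor [Num.min 1 (e ^+ 2)] compares the weighted norm of [low] with the norm of the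
     product. *)
  - move=> d d0; have m0 : 0 < Num.min 1 (e ^+ 2) by rewrite lt_min ltr01 exprn_gt0.
    have [N hN] := cs _ (mulr_gt0 d0 m0).
    exists N => m n hm hn; have := hN m n hm hn.
    rewrite sqd_prod [in X in X -> _]/sqd !rs diff => hd; rewrite /sqd.
    rewrite -(ltr_pM2r m0); apply: le_lt_trans hd.
    apply: le_trans (low _ (submodB sA (Ar m) (Ar n))).
    have := hf_ge0 (rform ip) (r m - r n).1; have := hf_ge0 (rform ip) (r m - r n).2.
    set x := rr _ _; set y := rr _ _ => x0 y0.
    rewrite mulrDl lerD//; first by rewrite ler_piMr// ge_min lexx.
    by rewrite mulrC ler_wpM2r// ge_min lexx orbT.
  exists (p.1 + e%:C%C *: p.2); first by exists p.
  move=> d d0; have m0 : 0 < 2 * (1 + e ^+ 2) by rewrite mulr_gt0// addr_gt0 ?exprn_gt0.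
  have [N hN] := rp _ (divr_gt0 d0 m0).
  exists N => n /hN; rewrite ltr_pdivlMr// /sqd rs diff; apply: le_lt_trans.
  move: (r n - p) => [x y].
  change (rr (x + e%:C%C *: y) (x + e%:C%C *: y) <=
    (rr x x + rr y y) * (2 * (1 + e ^+ 2))).
  have := hf_ge0 (rform ip) (x - e%:C%C *: y); rewrite !hfE (hfC _ y x).
  have := hf_ge0 (rform ip) x; have := hf_ge0 (rform ip) y.
  have e2 : 0 < e ^+ 2 by rewrite exprn_gt0.
  move: (rr x x) (rr x y) (rr y y) => a c b b0 a0.
  have := mulr_ge0 (ltW e2) a0; nra.
have [||| _ [p Ap <-] hp] := @projection _ _ (rform ip) W h _ _ _ cW.
- exists 0; first by case/submod_closedE: sA.
  by rewrite scaler0 addr0.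
- move=> _ _ [p Ap <-] [q Aq <-]; exists (p + q); first exact: submodD.
  by rewrite scalerDr addrACA.
- move=> a _ [p Ap <-]; exists (a%:C%C *: p); first exact: submodZ.
  by rewrite scalerDr !scalerA mulrC.
exists p => //; move: hp; have [k kE] : exists k, k = h - (p.1 + e%:C%C *: p.2).
  by eexists.
rewrite -kE => hp.
have Ak : A (e%:C%C *: k, - k).
  apply: nsa_mem => q Aq /=; have : W (q.1 + e%:C%C *: q.2) by exists q.
  by move=> /hp; rewrite !hfE (hfC _ k q.1) (hfC _ k q.2); lra.
have := nsa_ge0 Ak; rewrite /= !hfE => h0.
have k0 : rr k k <= 0.
  by rewrite leNgt; apply/negP => k0; have := mulr_gt0 e0 k0; lra.
have /rp_eq0/eqP : rr k k = 0 by apply: le_anti; rewrite k0 hf_ge0.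
by rewrite kE subr_eq0 => /eqP.
Qed.

End Facts.

(** Nonnegativity in [R[i]] includes a vanishing imaginary part, which symmetry of [p] against
    ['i *: p] provides. *)
Lemma lr_nonnegative_rr A : submod_closed [in A] ->
  (forall p q, A p -> A q -> rr p.2 q.1 = rr p.1 q.2) ->
  (forall p, A p -> 0 <= rr p.2 p.1) -> lr_nonnegative ip A.
Proof.
move=> sA symA geA p Ap; rewrite ip_rp lecE /= (geA _ Ap) andbT.
have := symA p ('i%C *: p) Ap (submodZ sA _ Ap).
rewrite /= (hfC _ p.1) rr_iC; rewrite -[rp ip _ _]/(rr _ _).
by move=> h; apply/eqP; lra.
Qed.

(** A symmetric relation with [1 + A] onto is selfadjoint: given [q] in the adjoint, pick [p] in [A]
    with the same sum of components; the difference [{k, - k}] is then killed by pairing with a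
    member of [A] whose components sum to [k]. Closedness is inherited from the adjoint. *)
Lemma nsa_intro A : submod_closed [in A] ->
  (forall p q, A p -> A q -> rr p.2 q.1 = rr p.1 q.2) ->
  (forall p, A p -> 0 <= rr p.2 p.1) ->
  (forall h, exists2 p, A p & p.1 + p.2 = h) -> nonneg_selfadjoint ip A.
Proof.
move=> sA symA geA ranA.
have adjA : lr_adjoint ip A = A.
  apply/seteqP; split=> q; last first.
    by move=> Aq; apply/adjoint_rr => // p Ap; exact: symA.
  move=> /(adjoint_rr _ sA) hq.
  have [p Ap pq] := ranA (q.1 + q.2).
  have [k kE] : exists k, k = q.1 - p.1 by eexists.
  have k2 : q.2 - p.2 = - k.
    by rewrite kE opprB; apply/eqP; rewrite subr_eq addrAC eq_sym subr_eq pq addrC.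
  have [r Ar rk] := ranA k.
  have k0 : k = 0.
    apply: (@rp_eq0 _ _ ip); change (rr k k = 0); rewrite -{1}rk hfDl.
    have := hq _ Ar; have := symA _ _ Ar Ap.
    have : rr r.1 (q.2 - p.2) = rr r.1 (- k) by rewrite k2.
    by rewrite kE !hfE; lra.
  suff -> : q = p by [].
  rewrite [q]surjective_pairing [p]surjective_pairing.
  rewrite k0 oppr0 in k2; rewrite k0 in kE.
  by rewrite (subr0_eq k2) (subr0_eq (esym kE)).
split => //.
- split=> //; apply/(closed_sqd2 ip_norm); rewrite -adjA; exact: adjoint_closed.
- exact: lr_nonnegative_rr.
Qed.

Lemma nsa_inverse A : nonneg_selfadjoint ip A -> nonneg_selfadjoint ip (lr_inverse A).
Proof.
move=> nsaA; apply: nsa_intro.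
- apply/submod_closedE; have /submod_closedE[A0 AD] := nsa_submod nsaA.
  by split=> // a [u1 u2] [v1 v2]; exact: AD.
- by move=> [p1 p2] [q1 q2] Ap Aq /=; rewrite -(nsa_sym nsaA Ap Aq).
- by move=> [p1 p2] Ap /=; rewrite hfC; exact: (nsa_ge0 nsaA Ap).
- move=> h; have [[p1 p2] Ap <-] := nsa_range nsaA h ltr01.
  by exists (p2, p1) => //=; rewrite scale1r addrC.
Qed.

Lemma lr_inverseK A : lr_inverse (lr_inverse A) = A.
Proof. by apply/seteqP; split=> -[]. Qed.

End NonnegSelfadjoint.

(** * Forms and the relations T* T *)

Lemma hf_iC (R : realType) (V : lmodType R[i]) (b : hform V) u v :
  b ('i%C *: u) v = - b u ('i%C *: v).
Proof.
by rewrite -[LHS]hfi scalerA -expr2 sqr_i scaleN1r hfNl.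
Qed.

Lemma hfcZ (R : realType) (V : lmodType R[i]) (b : hform V) (a : R[i]) u v :
  b (a *: u) v = complex.Re a * b u v - complex.Im a * b u ('i%C *: v).
Proof.
rewrite {1}[a]complexE scalerDl mulrC -scalerA hfDl !hfZl hf_iC; ring.
Qed.

Section FormRelation.
Variables (R : realType) (H : completeNormedModType R[i]).
Variable ip : inner_product H.
Hypothesis ip_norm : induces_norm ip.

Local Notation rr := (hf (rform ip)).
Local Notation sq2 := (prod_hform (rform ip) (rform ip)).

(* Equivalent to [f] being in the form domain of [A] with [A[f] <= c]
   (see [form_ub_sqrt]). *)
Definition form_ub (A : set (H * H)) (f : H) (c : R) : Prop :=
  forall p, A p -> 2 * rr f p.2 - rr p.2 p.1 <= c.

Lemma form_ub_le A f c d : form_ub A f c -> c <= d -> form_ub A f d.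
Proof. by move=> fc cd p /fc h; exact: le_trans cd. Qed.

Lemma form_ub_ge0 A f c : nonneg_selfadjoint ip A -> form_ub A f c -> 0 <= c.
Proof.
move=> nsaA /(_ 0); case/submod_closedE: (nsa_submod nsaA) => A0 _ /(_ A0).
by rewrite !hf0r; lra.
Qed.

(** Nonnegativity at [p - q], expanded with the help of symmetry. *)
Lemma form_ub_mem A p : nonneg_selfadjoint ip A -> A p ->
  form_ub A p.1 (rr p.2 p.1).
Proof.
move=> nsaA Ap q Aq.
have := nsa_ge0 nsaA (submodB (nsa_submod nsaA) Ap Aq).
have := nsa_sym nsaA Ap Aq.
rewrite /= !hfE (hfC _ q.2 p.1); lra.
Qed.

Lemma resolvent_bound A f c (e : R) : nonneg_selfadjoint ip A -> form_ub A f c ->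
  0 < e -> exists p, [/\ A p, p.1 + e%:C%C *: p.2 = f &
                         rr p.2 p.1 + 2 * e * rr p.2 p.2 <= c].
Proof.
move=> nsaA fc e0; have [p Ap pf] := nsa_range ip_norm nsaA f e0.
exists p; split=> //; have := fc _ Ap.
by rewrite -pf !hfE (hfC _ p.1 p.2); lra.
Qed.

(* The point [p.1] is [(1 + d A)^-1 f] with [d = e / (c + 1)]. *)
Lemma resolvent_approx A f c (e : R) : nonneg_selfadjoint ip A -> form_ub A f c ->
  0 < e -> exists p, [/\ A p, rr p.2 p.1 <= c & sqd (rform ip) f p.1 < e].
Proof.
move=> nsaA fc e0; have c0 := form_ub_ge0 nsaA fc.
have d0 : 0 < e / (c + 1) by rewrite divr_gt0// ltr_wpDl.
have [p [Ap <- hp]] := resolvent_bound nsaA fc d0.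
have p0 := nsa_ge0 nsaA Ap; have p20 := hf_ge0 (rform ip) p.2.
exists p; split=> //.
  by have := mulr_ge0 (ltW d0) p20; lra.
rewrite /sqd addrC addKr !hfE.
have ed : e = e / (c + 1) * (c + 1) by rewrite divfK// gt_eqF// ltr_wpDl.
rewrite [ltRHS]ed; move: (e / (c + 1)) d0 hp => d d0 hp.
by rewrite ltr_pM2l//; have := mulr_ge0 (ltW d0) p20; lra.
Qed.

Section TstarT.
Variables (G : lmodType R[i]) (bG : hform G) (T : set (H * G)).
Hypothesis sT : submod_closed [in T].
Hypothesis cT : complete_for (prod_hform (rform ip) bG) T.

(* This is [T^* T]; its form is [f |-> |T f|^2] on [dom T]. *)
Definition form_relation : set (H * H) := [set p | exists2 g, T (p.1, g) &
  forall q, T q -> bG g q.2 = rr p.2 q.1].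

(** Von Neumann's argument: the projection [(f, g)] of [(h, 0)] onto the graph [T] satisfies
    [T^* g = h - f], so [{f, h - f}] solves the resolvent equation. Density of the domain is not
    assumed, whence a relation and not an operator. *)
Lemma form_relation_nsa : nonneg_selfadjoint ip form_relation.
Proof.
have [T0 TD] := (submod_closedE _).1 sT.
apply: nsa_intro => //.
- apply/submod_closedE; split.
    by exists 0 => // q _; rewrite !hf0l.
  move=> a p p' [g Tg hg] [g' Tg' hg']; exists (a *: g + g').
    exact: TD a _ _ Tg Tg'.
  move=> q Tq; rewrite /= !hfDl !hfcZ hg// hg'//.
  by have /= -> := hg _ (submodZ sT 'i%C Tq).
- move=> p q [g Tg hg] [g' Tg' hg'].
  by have /= <- := hg _ Tg'; have /= := hg' _ Tg; rewrite hfC (hfC _ p.1).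
- by move=> p [g Tg /(_ _ Tg) /= <-]; exact: hf_ge0.
- move=> h.
  have [|||[f g] Tfg hfg] := @projection _ _ (prod_hform (rform ip) bG) T (h, 0) _ _ _ cT.
  + exact: T0.
  + exact: submodD.
  + by move=> a; exact: submodZ.
  exists (f, h - f) => /=; last by rewrite addrC subrK.
  exists g => // q Tq; have := hfg _ Tq.
  rewrite /hf /= /prod_hf /= sub0r hfNl => /eqP.
  by rewrite subr_eq0 => /eqP.
Qed.

(* [|g'|^2 + |f - p.1|^2 / e] is minimal at the resolvent [p.1], and exceeds its
   minimum by the squared distance to the minimizer. *)
Lemma resolvent_minimal f (e : R) p g q :
  0 < e -> p.1 + e%:C%C *: p.2 = f -> T (p.1, g) ->
  (forall q, T q -> bG g q.2 = rr p.2 q.1) -> T q ->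
  bG q.2 q.2 + sqd (rform ip) f q.1 / e =
  bG g g + e * rr p.2 p.2 + sqd bG q.2 g + sqd (rform ip) q.1 p.1 / e.
Proof.
move=> e0 <- Tp hg Tq.
have := hg _ Tq; have := hg _ Tp; rewrite /sqd /= !hfE.
rewrite (hfC _ q.2 g) (hfC _ p.1 p.2) (hfC _ q.1 p.2) (hfC _ q.1 p.1) => h1 h2.
rewrite h1 h2; field; by rewrite gt_eqF.
Qed.

(** From right to left, the square of [g - g'] is nonnegative. Conversely, the resolvents of [f] at
    [e n = 1 / (n + 1)] have energies [m n], minimal values of a penalized problem, which increase
    and stay below [c]. Their increments control the images [g n], so the pairs converge in the
    complete [T], with first component [f]. *)
Lemma form_ub_relation f c : form_ub form_relation f c <->
  exists2 g, T (f, g) & bG g g <= c.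
Proof.
split; last first.
  move=> [g Tg gc] p [g' Tg' hg'].
  have := hg' _ Tg; have := hg' _ Tg'; rewrite /= (hfC _ f) => <- <-.
  by have := hf_ge0 bG (g - g'); rewrite !hfE (hfC _ g g'); lra.
move=> fc.
pose e n : R := n.+1%:R^-1; have e0 n : 0 < e n by rewrite invr_gt0.
have /choice[p hp] n := resolvent_bound form_relation_nsa fc (e0 n).
have Ap n : form_relation (p n) by case: (hp n).
have pf n : (p n).1 + (e n)%:C%C *: (p n).2 = f by case: (hp n).
have pc n : rr (p n).2 (p n).1 + 2 * e n * rr (p n).2 (p n).2 <= c by case: (hp n).
have /choice[g hg] n : exists g, T ((p n).1, g) /\
    forall q, T q -> bG g q.2 = rr (p n).2 q.1.
  by have [g] := Ap n; exists g.
have Tg n := (hg n).1.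
pose m n := bG (g n) (g n) + e n * rr (p n).2 (p n).2.
have en0 n : 0 <= e n * rr (p n).2 (p n).2 by rewrite mulr_ge0 ?hf_ge0// ltW.
have sqe n : sqd (rform ip) f (p n).1 = e n ^+ 2 * rr (p n).2 (p n).2.
  by rewrite -(pf n) /sqd addrC addKr !hfE; ring.
have bGg n : bG (g n) (g n) = rr (p n).2 (p n).1 by have := (hg n).2 _ (Tg n).
have mc n : m n <= c by rewrite /m bGg; have := pc n; have := en0 n; lra.
(* The [j]-th pair is a competitor in the [i]-th problem; its penalty only shrinks when [e i]
   replaces [e j]. *)
have mono i j : (i <= j)%N -> sqd bG (g j) (g i) <= m j - m i.
  move=> ij; have := resolvent_minimal (e0 i) (pf i) (Tg i) (hg i).2 (Tg j).
  rewrite /= -/(m i) sqe => h.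
  have : 0 <= sqd (rform ip) (p j).1 (p i).1 / e i.
    by rewrite divr_ge0 ?sqd_ge0// ltW.
  have : e j ^+ 2 * rr (p j).2 (p j).2 / e i <= e j * rr (p j).2 (p j).2.
    rewrite ler_pdivrMr// expr2 -!mulrA ler_pM2l// [leRHS]mulrC ler_wpM2r ?hf_ge0//.
    by rewrite /e lef_pV2 ?posrE// ler_nat.
  by move: h; rewrite {2}/m; lra.
have cg : cauchy_for bG g.
  move=> d d0.
  have mono' i j : (i <= j)%N -> m i <= m j.
    by move=> /mono; have := sqd_ge0 bG (g j) (g i); lra.
  have [N hN] := bounded_nondecreasing_cauchy mono' mc d0.
  exists N => i j Ni Nj.
  have [ij|/ltnW ji] := leqP i j.
    by rewrite sqdC; apply: le_lt_trans (mono _ _ ij) _; exact: hN.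
  by apply: le_lt_trans (mono _ _ ji) _; exact: hN.
have tp : tends_to (rform ip) (fun n => (p n).1) f.
  move=> d d0.
  have c0 : 0 <= c := form_ub_ge0 form_relation_nsa fc.
  have [N hN] := inv_natS_small (divr_gt0 d0 (ltr_wpDl c0 ltr01)).
  exists N => n /hN; rewrite ltr_pdivlMr ?ltr_wpDl// -/(e n) => hn.
  rewrite sqdC sqe; apply: le_lt_trans hn.
  rewrite expr2 -mulrA ler_pM2l//.
  by have := pc n; rewrite -bGg; have := hf_ge0 bG (g n); have := en0 n; lra.
have [||[f' l] Tl tl] := cT (s := fun n => ((p n).1, g n)).
- exact: Tg.
- move=> d d0; have d2 : 0 < d / 2 by rewrite divr_gt0.
  have [N1 h1] := tends_to_cauchy tp d2; have [N2 h2] := cg _ d2.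
  exists (maxn N1 N2) => i j; rewrite !geq_max => /andP[i1 i2] /andP[j1 j2].
  by rewrite sqd_prod [ltRHS](splitr d) ltrD ?h1 ?h2.
have tl1 : tends_to (rform ip) (fun n => (p n).1) f'.
  move=> d /tl[N hN]; exists N => n /hN; rewrite sqd_prod; apply: le_lt_trans.
  by rewrite lerDl sqd_ge0.
have tl2 : tends_to bG g l.
  move=> d /tl[N hN]; exists N => n /hN; rewrite sqd_prod; apply: le_lt_trans.
  by rewrite lerDr sqd_ge0.
have /(@rp_eq0 _ _ ip)/subr0_eq ff : rr (f - f') (f - f') = 0.
  exact: tends_to_unique tp tl1.
exists l; first by rewrite ff.
apply: tends_to_bound tl2 _ => n; have := mc n; rewrite /m; have := en0 n; lra.
Qed.

End TstarT.

End FormRelation.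

(** * Square roots of bounded operators *)

Section BoundedSqrt.
Variables (R : realType) (H : completeNormedModType R[i]).
Variable ip : inner_product H.
Hypothesis ip_norm : induces_norm ip.

Local Notation rr := (hf (rform ip)).

Definition symmetric_op (W : H -> H) : Prop :=
  (forall a u v, W (a *: u + v) = a *: W u + W v) /\
  (forall u v, rr (W u) v = rr u (W v)).

Lemma rr_inj u v : (forall w, rr u w = rr v w) -> u = v.
Proof.
move=> h; apply/subr0_eq/(@rp_eq0 _ _ ip); change (rr (u - v) (u - v) = 0).
by rewrite hfDl hfNl h subrr.
Qed.

Section SymmetricOp.
Variable W : H -> H.
Hypothesis symW : symmetric_op W.

Lemma symopD u v : W (u + v) = W u + W v.
Proof. by have := symW.1 1 u v; rewrite !scale1r. Qed.

Lemma symop0 : W 0 = 0.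
Proof. by have := symopD 0 0; rewrite addr0 => /(congr1 (fun x => x - W 0)); rewrite addrK subrr. Qed.

Lemma symopZ a u : W (a *: u) = a *: W u.
Proof. by have := symW.1 a u 0; rewrite symop0 !addr0. Qed.

Lemma symopN u : W (- u) = - W u.
Proof. by rewrite -scaleN1r symopZ scaleN1r. Qed.

Lemma symopB u v : W (u - v) = W u - W v.
Proof. by rewrite symopD symopN. Qed.

Lemma symop_subid : symmetric_op (fun x => x - W x).
Proof.
split=> [a u v|u v]; first by rewrite symW.1 scalerBr opprD addrACA.
by rewrite !hfE symW.2.
Qed.

End SymmetricOp.

(** The norm with values in [R] instead of [R[i]]. *)
Definition nm (x : H) : R := Num.sqrt (rr x x).

Lemma nm_ge0 x : 0 <= nm x.
Proof. exact: sqrtr_ge0. Qed.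

Lemma nm_sq x : nm x ^+ 2 = rr x x.
Proof. by rewrite sqr_sqrtr// hf_ge0. Qed.

Lemma nmZ (a : R) x : 0 <= a -> nm (a%:C%C *: x) = a * nm x.
Proof.
by move=> a0; rewrite /nm !hfE mulrA -expr2 sqrtrM ?sqr_ge0// sqrtr_sqr ger0_norm.
Qed.

Lemma nm_triangle x y : nm (x + y) <= nm x + nm y.
Proof.
rewrite -(@ler_pXn2r _ 2)// ?nnegrE ?nm_ge0 ?addr_ge0 ?nm_ge0//.
rewrite nm_sq !hfE (hfC _ y x) -!nm_sq.
suff : rr x y <= nm x * nm y by nra.
have := cauchy_schwarz (rform ip) x y; rewrite -!nm_sq => h.
rewrite leNgt; apply/negP => c; have := mulr_ge0 (nm_ge0 x) (nm_ge0 y).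
by move: (nm x) (nm y) h c => a b h c ab; nra.
Qed.

(** Identities between limit operators are checked against test vectors: limits of reals are unique
    and [rr_inj] concludes. *)
Lemma tends_to_weak s u v : tends_to (rform ip) s u ->
  (rr (s n) v @[n --> \oo] --> rr u v)%classic.
Proof.
move=> su; apply/cvgrPdist_lt => e e0.
have v0 : 0 < rr v v + 1 by rewrite ltr_wpDl ?hf_ge0.
have [N hN] := su _ (divr_gt0 (exprn_gt0 2 e0) v0).
exists N => // n /hN; rewrite ltr_pdivlMr// => h.
rewrite distrC -[rr (s n) v - _](_ : rr (s n - u) v = _); last by rewrite !hfE.
rewrite -(@ltr_pXn2r _ 2)// ?nnegrE ?ltW// real_normK ?num_real//.
apply: le_lt_trans (cauchy_schwarz _ _ _) _; apply: le_lt_trans h.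
by rewrite /sqd ler_wpM2l ?hf_ge0 ?lerDl.
Qed.

Lemma limit_unique (f g : nat -> R) (l m : R) :
  (f n @[n --> \oo] --> l)%classic -> (g n @[n --> \oo] --> m)%classic -> f =1 g ->
  l = m.
Proof. by move=> fl gm /funext fg; apply: cvg_unique fl _ => //; rewrite fg. Qed.

(** * The iteration for the square root of [1 - U] *)

Section SqrtIteration.
Variable U : H -> H.
Hypothesis symU : symmetric_op U.
Hypothesis contractU : forall x, rr (U x) (U x) <= rr x x.

(* [sqrt (1 - U) = 1 - Y] where [Y] solves [Y = (U + Y^2) / 2]; the scalar
   iteration [sqrt_bound] dominates the operator iteration in norm. *)
Fixpoint sqrt_iter n x : H :=
  if n is m.+1 then (2^-1)%:C%C *: (U x + sqrt_iter m (sqrt_iter m x)) else 0.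

Fixpoint sqrt_bound n : R :=
  if n is m.+1 then (1 + sqrt_bound m ^+ 2) / 2 else 0.

Lemma sqrt_iter_sym n : symmetric_op (sqrt_iter n).
Proof.
elim: n => [|n ih]; first by split=> [a u v|u v] /=; rewrite ?scaler0 ?addr0// hf0l hf0r.
split=> [a u v|u v] /=.
  rewrite symU.1 !ih.1 scalerA mulrC -scalerA -scalerDr; congr (_ *: _).
  by rewrite scalerDr addrACA.
by rewrite !hfE symU.2 !ih.2.
Qed.

Lemma sqrt_bound_itv n : 0 <= sqrt_bound n <= 1.
Proof.
elim: n => [|n /andP[h0 h1]] /=; first by rewrite lexx ler01.
by apply/andP; split; nra.
Qed.

Lemma sqrt_boundS n : sqrt_bound n <= sqrt_bound n.+1.
Proof. by rewrite /=; have := sqr_ge0 (1 - sqrt_bound n); lra. Qed.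

Lemma sqrt_iter_le n x : nm (sqrt_iter n x) <= sqrt_bound n * nm x.
Proof.
elim: n x => [|n ih] x /=; first by rewrite /nm hf0l sqrtr0 mul0r.
have /andP[b0 _] := sqrt_bound_itv n.
rewrite nmZ ?invr_ge0//.
have := nm_triangle (U x) (sqrt_iter n (sqrt_iter n x)).
have : nm (U x) <= nm x by rewrite ler_wsqrtr.
have := ih (sqrt_iter n x); have := ler_wpM2l b0 (ih x).
by rewrite expr2; lra.
Qed.

(** Induction on the splitting [Y1^2 - Y0^2 = Y1 (Y1 - Y0) + (Y1 - Y0) Y0], valid without
    commutation and mirrored exactly by the scalar sequence. *)
Lemma sqrt_iterS n x : nm (sqrt_iter n.+1 x - sqrt_iter n x) <=
  (sqrt_bound n.+1 - sqrt_bound n) * nm x.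
Proof.
elim: n x => [|n ih] x.
  rewrite /= addr0 subr0 nmZ ?invr_ge0// expr0n /=.
  have : nm (U x) <= nm x by rewrite ler_wsqrtr.
  by lra.
set b1 := sqrt_bound n.+1; set b0 := sqrt_bound n.
set Y1 := sqrt_iter n.+1; set Y0 := sqrt_iter n.
have -> : sqrt_iter n.+2 x - Y1 x =
    (2^-1)%:C%C *: (Y1 (Y1 x - Y0 x) + (Y1 (Y0 x) - Y0 (Y0 x))).
  rewrite (symopB (sqrt_iter_sym n.+1 : symmetric_op Y1)) addrA subrK.
  have e1 : Y1 x = (2^-1)%:C%C *: (U x + Y0 (Y0 x)) by [].
  have e2 : sqrt_iter n.+2 x = (2^-1)%:C%C *: (U x + Y1 (Y1 x)) by [].
  rewrite e2 [X in _ - X = _]e1 -scalerBr.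
  by congr (_ *: _); rewrite opprD addrACA subrr add0r.
have -> : sqrt_bound n.+2 - b1 = 2^-1 * (b1 * (b1 - b0) + (b1 - b0) * b0).
  by rewrite -[sqrt_bound n.+2]/((1 + b1 ^+ 2) / 2) {2}/b1 /= -/b0; field.
have /andP[b00 _] := sqrt_bound_itv n; have /andP[b10 _] := sqrt_bound_itv n.+1.
have b01 := sqrt_boundS n.
rewrite nmZ ?invr_ge0// -mulrA ler_pM2l ?invr_gt0//.
apply: le_trans (nm_triangle _ _) _; rewrite mulrDl lerD//.
  apply: le_trans (sqrt_iter_le _ _) _; rewrite -mulrA ler_wpM2l//; exact: ih.
apply: le_trans (ih _) _; rewrite -mulrA ler_wpM2l ?subr_ge0//.
exact: sqrt_iter_le.
Qed.

Lemma sqrt_bound_mono i j : (i <= j)%N -> sqrt_bound i <= sqrt_bound j.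
Proof.
move=> ij; rewrite -(subnK ij); elim: (j - i)%N => //= n ih.
exact: le_trans ih (sqrt_boundS _).
Qed.

Lemma sqrt_iter_dist i j x : (i <= j)%N ->
  nm (sqrt_iter j x - sqrt_iter i x) <= (sqrt_bound j - sqrt_bound i) * nm x.
Proof.
move=> ij; rewrite -(subnK ij); elim: (j - i)%N => [|n ih].
  by rewrite add0n !subrr /nm hf0l sqrtr0 mul0r.
rewrite addSn; set k := (n + i)%N in ih *.
have := nm_triangle (sqrt_iter k.+1 x - sqrt_iter k x) (sqrt_iter k x - sqrt_iter i x).
by rewrite addrA subrK; have := sqrt_iterS k x; lra.
Qed.

Lemma sqrt_iter_cvg x : exists l, tends_to (rform ip) (fun n => sqrt_iter n x) l.
Proof.
have [|l _] := hilbert_complete ip_norm (fun=> I) (s := fun n => sqrt_iter n x).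
  move=> e e0.
  have x0 : 0 < rr x x + 1 by rewrite ltr_wpDl ?hf_ge0.
  have [N hN] := bounded_nondecreasing_cauchy sqrt_bound_mono
    (fun n => proj2 (andP (sqrt_bound_itv n))) (divr_gt0 e0 x0).
  have main i j : (N <= i)%N -> (i <= j)%N ->
      sqd (rform ip) (sqrt_iter j x) (sqrt_iter i x) < e.
    move=> Ni ij; have := hN _ _ Ni ij; rewrite ltr_pdivlMr//; apply: le_lt_trans.
    have := sqrt_iter_dist x ij; have := sqrt_bound_mono ij.
    have /andP[i0 i1] := sqrt_bound_itv i; have /andP[j0 j1] := sqrt_bound_itv j.
    rewrite /sqd -!nm_sq; move: (nm_ge0 (sqrt_iter j x - sqrt_iter i x)) (nm_ge0 x).
    move: (nm _) (nm _) => b a a0 b0 ij1 ab.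
    have d0 : 0 <= sqrt_bound j - sqrt_bound i by rewrite subr_ge0.
    have d1 : sqrt_bound j - sqrt_bound i <= 1 by lra.
    move: (sqrt_bound j - sqrt_bound i) ab d0 d1 => d ab d0 d1.
    have := mulr_ge0 d0 b0 => db0.
    (* Since [0 <= d <= 1], the square of [d] is at most [d], so the bound on scalar increments
       suffices for squared distances. *)
    have h1 : a ^+ 2 <= (d * b) ^+ 2 by rewrite ler_pXn2r ?nnegrE.
    have h2 : (d * b) ^+ 2 <= d * b ^+ 2.
      by rewrite exprMn ler_wpM2r ?sqr_ge0// expr2 ler_piMr.
    by lra.
  exists N => i j Ni Nj; have [ij|/ltnW ij] := leqP i j.
    by rewrite sqdC main.
  exact: main.
by exists l.
Qed.

(** Here [Q = 1 - Y] for the limit [Y] of the iteration. Contractivity of [1 - Q] allows a second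
    application to [Q] itself, and the last clause makes roots of commuting operators commute. *)
Lemma bounded_sqrt : exists Q : H -> H, [/\ symmetric_op Q,
  forall x, 0 <= rr (Q x) x, forall x, Q (Q x) = x - U x,
  forall x, rr (x - Q x) (x - Q x) <= rr x x &
  forall W, symmetric_op W -> (forall x, W (U x) = U (W x)) ->
    forall x, W (Q x) = Q (W x)].
Proof.
have /choice[Y hY] := sqrt_iter_cvg.
have weak x v := tends_to_weak (v := v) (hY x).
have contractn n x : rr (sqrt_iter n x) (sqrt_iter n x) <= rr x x.
  rewrite -!nm_sq ler_pXn2r ?nnegrE ?nm_ge0//.
  apply: le_trans (sqrt_iter_le _ _) _; rewrite ler_piMl ?nm_ge0//.
  by case/andP: (sqrt_bound_itv n).
have contractY x : rr (Y x) (Y x) <= rr x x := tends_to_bound (hY x) (contractn^~ x).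
have symY : symmetric_op Y.
  split=> [a u v|u v].
    apply: rr_inj => w; rewrite hfDl hfcZ.
    apply: (limit_unique (weak _ w)); last first.
      by move=> n; rewrite (sqrt_iter_sym _).1 hfDl hfcZ.
    by apply: cvgD; [apply: cvgB; apply: cvgMr; exact: weak|exact: weak].
  rewrite [RHS]hfC; apply: (limit_unique (weak u v) (weak v u)) => n.
  by rewrite (sqrt_iter_sym _).2 hfC.
have YY x : Y x + Y x = U x + Y (Y x).
  have t2 : tends_to (rform ip) (fun n => sqrt_iter n (sqrt_iter n x)) (Y (Y x)).
    move=> e e0; have e4 : 0 < e / 4 by rewrite divr_gt0.
    have [N1 h1] := hY x _ e4; have [N2 h2] := hY (Y x) _ e4.
    exists (maxn N1 N2) => n; rewrite geq_max => /andP[/h1 k1 /h2 k2].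
    have := sqd_tri (rform ip) (sqrt_iter n (sqrt_iter n x)) (sqrt_iter n (Y x)) (Y (Y x)).
    have : sqd (rform ip) (sqrt_iter n (sqrt_iter n x)) (sqrt_iter n (Y x)) < e / 4.
      by rewrite /sqd -(symopB (sqrt_iter_sym n)); exact: le_lt_trans (contractn _ _) k1.
    by move: k2; lra.
  have t1 : tends_to (rform ip) (fun n => sqrt_iter n.+1 x) (Y x).
    by move=> e /(hY x)[N hN]; exists N => n Nn; apply: hN; exact: leqW.
  apply: rr_inj => v.
  have : rr (Y x) v = 2^-1 * (rr (U x) v + rr (Y (Y x)) v).
    apply: (limit_unique (tends_to_weak (v := v) t1)); last first.
      by move=> n; rewrite /= hfZl hfDl.
    by apply: cvgMr; apply: cvgD; [exact: cvg_cst|exact: tends_to_weak t2].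
  by rewrite !hfDl; lra.
exists (fun x => x - Y x); split.
- exact: symop_subid.
(* Twice the value is [|x - Y x|^2 + |x|^2 - |Y x|^2]. *)
- move=> x; rewrite !hfE; have := hf_ge0 (rform ip) (x - Y x).
  by rewrite !hfE (hfC _ x (Y x)); have := contractY x; lra.
- move=> x; rewrite (symopB symY); apply: rr_inj => v.
  by have := congr1 (rr^~ v) (YY x); rewrite !hfE; lra.
- by move=> x; rewrite opprB addrC subrK.
- move=> W symW WU x; rewrite (symopB symW); congr (_ - _).
  have Wn n z : W (sqrt_iter n z) = sqrt_iter n (W z).
    elim: n z => [|n ih] z /=; first exact: symop0.
    by rewrite (symopZ symW) (symopD symW) WU !ih.
  apply: rr_inj => v; rewrite symW.2.
  by apply: (limit_unique (weak x (W v)) (weak (W x) v)) => n; rewrite -Wn symW.2.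
Qed.

End SqrtIteration.

End BoundedSqrt.

(** * Square roots of relations and closed forms *)

Lemma pair_lin (K : nzRingType) (V1 V2 : lmodType K) a (x x' : V1) (y y' : V2) :
  a *: (x, y) + (x', y') = (a *: x + x', a *: y + y').
Proof. by []. Qed.

Lemma pair_sub (K : nzRingType) (V1 V2 : lmodType K) (x x' : V1) (y y' : V2) :
  (x, y) - (x', y') = (x - x', y - y').
Proof. by []. Qed.

Section SquareRoot.
Variables (R : realType) (H : completeNormedModType R[i]).
Variable ip : inner_product H.
Hypothesis ip_norm : induces_norm ip.

Local Notation rr := (hf (rform ip)).
Local Notation sq2 := (prod_hform (rform ip) (rform ip)).

Lemma orthocompl_rr (M : set H) x : submod_closed [in M] ->
  orthocompl ip M x <-> forall m, M m -> rr x m = 0.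
Proof.
move=> sM; split=> [hx m Mm|hx m Mm].
  by rewrite /hf /= /rp hx.
have e1 : rp ip x m = 0 := hx _ Mm.
have e2 : rp ip x ('i%C *: m) = 0 := hx _ (submodZ sM 'i%C Mm).
by rewrite ip_rp e1 e2.
Qed.

Lemma submod_orthocompl (M : set H) :
  submod_closed [in M] -> submod_closed [in orthocompl ip M].
Proof.
move=> sM; apply/submod_closedE; split; first by move=> m _; rewrite linear0l.
move=> a u v /(orthocompl_rr _ sM) hu /(orthocompl_rr _ sM) hv.
apply/orthocompl_rr => // m Mm; rewrite hfDl hfcZ hu// hv// hu ?mulr0 ?subr0 ?addr0//.
exact: submodZ.
Qed.

Lemma closed_orthocompl (M : set H) :
  submod_closed [in M] -> closed_for (rform ip) (orthocompl ip M).
Proof.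
move=> sM u hu; apply/orthocompl_rr => // m Mm.
apply/eqP; rewrite -sqrf_eq0 eq_le sqr_ge0 andbT.
apply: (@le_of_small _ _ (rr m m)) => e e0.
have [w /(orthocompl_rr _ sM)/(_ _ Mm) hw uw] := hu e e0.
have -> : rr u m = rr (u - w) m by rewrite !hfE hw subr0.
apply: le_trans (cauchy_schwarz _ _ _) _.
by rewrite mulrC ler_wpM2l ?hf_ge0// ltW.
Qed.

Lemma submod_mul (A : set (H * H)) : submod_closed [in A] -> submod_closed [in lr_mul A].
Proof.
move=> /submod_closedE[A0 AD]; apply/submod_closedE; split=> // a u v Au Av.
by have := AD a _ _ Au Av; rewrite pair_lin scaler0 addr0.
Qed.

Lemma orthogonal_decomposition (M : set H) h : submod_closed [in M] ->
  closed_for (rform ip) M -> exists m k, [/\ M m, orthocompl ip M k & h = m + k].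
Proof.
move=> sM cM.
have [||||m Mm hm] := @projection _ _ (rform ip) M h.
- by case/submod_closedE: sM.
- exact: submodD.
- by move=> a; exact: submodZ.
- by apply: closed_complete => //; exact: hilbert_complete.
by exists m, (h - m); split=> //; [apply/orthocompl_rr|rewrite addrC subrK].
Qed.

(** * Existence of the square root of the operator part *)

Section Existence.
Variable A : set (H * H).
Hypothesis nsaA : nonneg_selfadjoint ip A.

Lemma nsa_resolvent_unique p q : A p -> A q -> p.1 + p.2 = q.1 + q.2 -> p = q.
Proof.
move=> Ap Aq pq.
have := nsa_ge0 nsaA (submodB (nsa_submod nsaA) Ap Aq).
have e : p.2 - q.2 = - (p.1 - q.1).
  by rewrite opprB; apply/eqP; rewrite subr_eq addrAC eq_sym subr_eq -pq addrC.
rewrite /= e hfNl oppr_ge0 => h.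
have /(@rp_eq0 _ _ ip) d0 : rr (p.1 - q.1) (p.1 - q.1) = 0.
  by apply: le_anti; rewrite h hf_ge0.
rewrite [p]surjective_pairing [q]surjective_pairing (subr0_eq d0).
by rewrite d0 oppr0 in e; rewrite (subr0_eq e).
Qed.

(** The operator [B = (1 + A)^-1]. Both contraction bounds come from expanding the square of
    [x = B x + (x - B x)], whose cross term is nonnegative. *)
Lemma resolvent_exists : exists B : H -> H, [/\ symmetric_op ip B,
  forall x, A (B x, x - B x), forall x y, A (x, y) -> x = B (x + y),
  forall x, rr (B x) (B x) <= rr x x &
  forall x, rr (x - B x) (x - B x) <= rr x x].
Proof.
have /choice[B hB] h : exists f, A (f, h - f).
  have [p Ap] := nsa_range ip_norm nsaA h ltr01; rewrite scale1r => <-.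
  by exists p.1; rewrite addrAC subrr add0r -surjective_pairing.
have uB x y : A (x, y) -> x = B (x + y).
  move=> Axy; have := nsa_resolvent_unique Axy (hB (x + y)).
  by rewrite /= addrC addrCA subrr addr0 addrC => /(_ erefl)[].
have ge h : rr (B h) (B h) + rr (h - B h) (h - B h) <= rr h h.
  have := nsa_ge0 nsaA (hB h); rewrite /=; move: (B h) => f.
  by rewrite !hfE (hfC _ f h); lra.
exists B; split=> //.
- split=> [a u v|u v].
    have /submod_closedE[_ AD] := nsa_submod nsaA.
    have := AD a _ _ (hB u) (hB v); rewrite pair_lin => /uB ->; congr B.
    by rewrite addrACA -scalerDr (addrC (B u)) subrK (addrC (B v)) subrK.
  have := nsa_sym nsaA (hB u) (hB v); rewrite /= !hfE; move: (B u) (B v) => f g.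
  by lra.
- by move=> x; have := ge x; have := hf_ge0 (rform ip) (x - B x); lra.
- by move=> x; have := ge x; have := hf_ge0 (rform ip) (B x); lra.
Qed.

Lemma sqrt_exists : exists S, is_sqrt_operator_part ip A S.
Proof.
have [B [symB AB uB contrB contrC]] := resolvent_exists.
pose C x := x - B x.
have symC : symmetric_op ip C by exact: symop_subid.
have BC x : B (C x) = C (B x) by rewrite /C (symopB symB).
(* The lemma extracts roots of [1 - U]: [U = C] gives [P = B^(1/2)], and [U = B] gives
   [Q = C^(1/2)]. *)
have [P [symP P0 PP contrP commP]] := bounded_sqrt ip_norm symC contrC.
have [Q [symQ Q0 QQ _ commQ]] := bounded_sqrt ip_norm symB contrB.
have {}PP x : P (P x) = B x by rewrite PP /C opprB addrC subrK.
have {}QQ x : Q (Q x) = C x by rewrite QQ.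
have QC x : C (Q x) = Q (C x) by apply: commQ => // y; rewrite BC.
have QP x : Q (P x) = P (Q x) by apply: commP => // y; rewrite QC.
(* With [D = P^(1/2)], which commutes with [Q], the value is that of the nonnegative form of [Q] at
   [D x]. *)
have pos x : 0 <= rr (Q x) (P x).
  have [D [symD _ DD _ commD]] := bounded_sqrt ip_norm (symop_subid symP) contrP.
  have {}DD y : D (D y) = P y by rewrite DD opprB addrC subrK.
  have QD y : Q (D y) = D (Q y) by apply: commD => // z; rewrite (symopB symQ) QP.
  by rewrite -DD -symD.2 -QD.
pose M := lr_mul A; pose K := orthocompl ip M.
have sM : submod_closed [in M] by exact: submod_mul (nsa_submod nsaA).
have sK : submod_closed [in K] by exact: submod_orthocompl.
have MB m : M m <-> B m = 0.
  split=> [/uB|Bm]; first by rewrite add0r.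
  by have := AB m; rewrite Bm subr0.
have kerP m : B m = 0 -> P m = 0.
  move=> Bm; apply: (@rp_eq0 _ _ ip); change (rr (P m) (P m) = 0).
  by rewrite symP.2 PP Bm hf0r.
have kerQ m : M m -> M (Q m).
  move=> /MB Bm; apply/MB.
  by rewrite -(PP (Q m)) -!QP (kerP m)// (symop0 symP) (symop0 symQ).
have KP x : K (P x).
  apply/orthocompl_rr => // m /MB/kerP Pm.
  by rewrite symP.2 Pm hf0r.
have KQ x : K x -> K (Q x).
  move=> /(orthocompl_rr _ sM) Kx; apply/orthocompl_rr => // m /kerQ Mm.
  by rewrite symQ.2 Kx.
have MK0 x : M x -> K x -> x = 0.
  move=> Mx /(orthocompl_rr _ sM)/(_ _ Mx) x0.
  exact: (@rp_eq0 _ _ ip).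
(* Formally [Q P^-1]. Since [mul A] is the kernel of [B], which [P] also kills, restricting to its
   complement [K] makes [S] single-valued. *)
pose S := [set (P x, Q x) | x in K].
have sS : submod_closed [in S].
  have /submod_closedE[K0 KD] := sK.
  apply/submod_closedE; split; first by exists 0; rewrite ?(symop0 symP) ?(symop0 symQ).
  move=> a _ _ [x Kx <-] [y Ky <-]; exists (a *: x + y); first exact: KD.
  by rewrite symP.1 symQ.1.
have symS p q : S p -> S q -> rr p.2 q.1 = rr p.1 q.2.
  by move=> [x Kx <-] [y Ky <-] /=; rewrite symQ.2 QP symP.2.
have adjS : lr_adjoint ip S `&` (K `*` K) = S.
  apply/seteqP; split=> [q [/(adjoint_rr _ _ sS) hq [/= Kq1 Kq2]]|q Sq].
    (* Testing [q] against the member of [S] generated by this very difference shows that it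
       vanishes; [P q.1 + Q q.2] then generates [q], because [B + C = 1]. *)
    have d0 : Q q.1 - P q.2 = 0.
      have Kd : K (Q q.1 - P q.2) by apply: (submodB sK) => //; exact: KQ.
      apply: (@rp_eq0 _ _ ip); set d := Q q.1 - P q.2 in Kd *.
      change (rr d d = 0); rewrite {2}/d hfDr hfNr -symQ.2 -symP.2.
      by rewrite (hq (P d, Q d)) ?subrr//; exists d.
    exists (P q.1 + Q q.2).
      by apply: (submodD sK) => //; exact: KQ.
    have e1 : P (Q q.2) = C q.1 by rewrite -QP -(subr0_eq d0) QQ.
    have e2 : Q (P q.1) = B q.2 by rewrite QP (subr0_eq d0) PP.
    rewrite (symopD symP) (symopD symQ) PP QQ e1 e2 /C.
    by rewrite ![B _ + _]addrC !subrK -surjective_pairing.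
  split; first by apply/adjoint_rr => // p Sp; exact: symS.
  by case: Sq => x Kx <-; split => //=; exact: KQ.
exists S; split; first split.
- split=> //; apply/(closed_sqd2 ip_norm); rewrite -adjS => q hq; split.
    by apply: adjoint_closed => // e /hq[w []]; exists w.
  by split; apply: (closed_orthocompl sM) => e /hq[w [_ [K1 K2]]];
    rewrite sqd_prod => we; [exists w.1|exists w.2] => //;
    apply: le_lt_trans we; rewrite ?lerDl ?lerDr sqd_ge0.
- by move=> _ [x Kx <-]; split=> /=; [exact: KP|exact: KQ].
- apply/seteqP; split=> [y [x Kx [Px <-]]|_ ->] /=.
    have Bx : B x = 0 by rewrite -PP Px (symop0 symP).
    by rewrite (MK0 x) ?(symop0 symQ)//; exact/MB.
  by case/submod_closedE: sS.
- exact: adjS.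
- by apply: lr_nonnegative_rr => // _ [x Kx <-] /=.
- apply/seteqP; split=> [[f h] /= [g [x Kx [<- <-]] [y Ky [Py <-]]]|[f h] [Afh Kh]].
    (* As [P y = Q x], the left side is [P (B x + C x)]; hence [{P x, Q y}] is the resolvent pair of
       [P x + Q y]. *)
    have xB : B (P x + Q y) = P x.
      have -> : B (P x + Q y) = P (P (P x)) + P (Q (P y)).
        by rewrite (symopD symB) -!PP QP.
      by rewrite Py QQ -(symopD symP) PP /C addrC subrK.
    split; last exact: KQ.
    by have := AB (P x + Q y); rewrite xB addrAC subrr add0r.
  have fB := uB _ _ Afh; have hC : h = C (f + h) by rewrite /C -fB addrAC subrr add0r.
  have Kz : K (f + h) by apply: (submodD sK) => //; rewrite fB -PP.
  exists (Q (P (f + h))).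
    by exists (P (f + h)) => //; rewrite PP -fB.
  by exists (Q (f + h)); [exact: KQ|rewrite QP QQ -hC].
Qed.

End Existence.

(** * The closed form as a least bound *)

Section ClosedForm.
Variable A : set (H * H).
Hypothesis nsaA : nonneg_selfadjoint ip A.

Local Notation S := (sqrt_operator_part ip A).

Lemma sqrt_operator_partP : is_sqrt_operator_part ip A S.
Proof. exact: (@xgetPex _ set0 [set S | is_sqrt_operator_part ip A S]) (sqrt_exists nsaA). Qed.

Lemma sqrt_submod : submod_closed [in S].
Proof. by case: sqrt_operator_partP => [[[]]]. Qed.

Lemma sqrt_complete : complete_for sq2 S.
Proof.
case: sqrt_operator_partP => [[[_ cS] _ _ _ _] _].
apply: closed_complete; last exact/closed_sqd2.
by apply: complete_prod; exact: hilbert_complete.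
Qed.

(** Taking the adjoint in all of [H] restores [mul A], which is orthogonal to the domain of [S]. One
    inclusion is enough: a selfadjoint relation has no proper symmetric extension. *)
Lemma form_relation_sqrt : form_relation ip (rform ip) S = A.
Proof.
have [[_ SK _ adjS _] SS] := sqrt_operator_partP.
have sA := nsa_submod nsaA; have sM := submod_mul sA.
have symS p q : S p -> S q -> rr p.2 q.1 = rr p.1 q.2.
  by move=> Sp; rewrite -{1}adjS => -[/(adjoint_rr _ _ sqrt_submod) h _]; exact: h.
have sub : A `<=` form_relation ip (rform ip) S.
  move=> [f f'] Aff'.
  have cM : closed_for (rform ip) (lr_mul A).
    move=> u hu; apply: (nsa_closed ip_norm nsaA) => e /hu[w Mw uw].
    by exists (0, w) => //; rewrite sqd_prod /= /sqd subrr hf0l add0r.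
  have [m [k [Mm Kk f'E]]] := orthogonal_decomposition f' sM cM.
  have : operator_part ip A (f, k).
    split=> //; have := submodB sA Aff' Mm.
    by rewrite pair_sub subr0 f'E addrC addKr.
  rewrite -SS => -[g Sfg Sgk]; exists g => // q Sq.
  rewrite /= f'E hfDl -(symS _ _ Sgk Sq) /=.
  have [/(orthocompl_rr _ sM)/(_ _ Mm) + _] := SK _ Sq.
  by rewrite hfC => ->; rewrite add0r.
have nsaF := form_relation_nsa ip_norm sqrt_submod sqrt_complete.
apply/seteqP; split=> // p Fp; apply: (nsa_mem nsaA) => q /sub Fq.
exact: (nsa_sym nsaF).
Qed.

Lemma form_ub_sqrt f c :
  form_ub ip A f c <-> exists2 g, S (f, g) & rr g g <= c.
Proof.
rewrite -{1}form_relation_sqrt.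
exact: (form_ub_relation ip_norm sqrt_submod sqrt_complete).
Qed.

Lemma apply_sqrt f g : S (f, g) -> apply_operator S f = g.
Proof.
move=> Sfg; apply: xget_unique => // h Sfh.
have [[_ _ mulS _ _] _] := sqrt_operator_partP.
have : lr_mul S (h - g).
  by have := submodB sqrt_submod Sfh Sfg; rewrite pair_sub subrr.
by rewrite mulS => /subr0_eq.
Qed.

Lemma closed_form_domP f : closed_form_dom ip A f <-> exists c, form_ub ip A f c.
Proof.
split=> [[g Sfg]|[c /form_ub_sqrt[g Sfg _]]]; last by exists g.
by exists (rr g g); apply/form_ub_sqrt; exists g.
Qed.

(** The value of the form is the least real bound; this lets later arguments on sums and order work
    with [form_ub] alone. *)
Lemma closed_formP f : closed_form_dom ip A f -> exists2 a : R,
  closed_form ip A f = a%:C%C & forall c, form_ub ip A f c <-> a <= c.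
Proof.
move=> [g Sfg]; exists (rr g g).
  by rewrite /closed_form (apply_sqrt Sfg) (norm_sq ip_norm).
move=> c; split=> [/form_ub_sqrt[h Sfh]|gc]; last by apply/form_ub_sqrt; exists g.
by rewrite -(apply_sqrt Sfg) -(apply_sqrt Sfh).
Qed.

End ClosedForm.

End SquareRoot.

(** * Form sums and shorted relations *)

Section FormSum.
Variables (R : realType) (H : completeNormedModType R[i]).
Variable ip : inner_product H.
Hypothesis ip_norm : induces_norm ip.
Implicit Types (A B C X Y : set (H * H)) (L : set H).

Local Notation rr := (hf (rform ip)).
Local Notation sq2 := (prod_hform (rform ip) (rform ip)).
Local Notation nsa := (nonneg_selfadjoint ip).

(** Compare [p] in [A] with the [q] in [B] having the same sum of components, so [p - q = {k, - k}].
    Each pair bounds the form at the other, and adding the two inequalities gives [|k|^2 <= 0]. *)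
Lemma form_ub_sub A B : nsa A -> nsa B ->
  (forall f c, form_ub ip A f c <-> form_ub ip B f c) -> A `<=` B.
Proof.
move=> nsaA nsaB AB p Ap.
have [q Bq] := nsa_range ip_norm nsaB (p.1 + p.2) ltr01; rewrite scale1r => qp.
have := (AB _ _).1 (form_ub_mem nsaA Ap) _ Bq.
have := (AB _ _).2 (form_ub_mem nsaB Bq) _ Ap.
have e : p.2 - q.2 = - (p.1 - q.1).
  by rewrite opprB; apply/eqP; rewrite subr_eq addrAC eq_sym subr_eq qp addrC.
have : rr (p.1 - q.1) (p.2 - q.2) = - rr (p.1 - q.1) (p.1 - q.1).
  by rewrite e hfNr.
rewrite [X in X = _ -> _]hfDr [X in X + _ = _ -> _]hfDl [X in _ + X = _ -> _]hfDl.
rewrite !hfNr !hfNl (hfC _ p.2 p.1) (hfC _ q.2 q.1) => h1 h2 h3.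
have := hf_ge0 (rform ip) (p.1 - q.1) => d0.
have {}d0 : rr (p.1 - q.1) (p.1 - q.1) = 0 by lra.
have {}d0 := @rp_eq0 _ _ ip _ d0.
rewrite d0 oppr0 in e.
by rewrite [p]surjective_pairing (subr0_eq d0) (subr0_eq e) -surjective_pairing.
Qed.

Lemma form_ub_inj A B : nsa A -> nsa B ->
  (forall f c, form_ub ip A f c <-> form_ub ip B f c) -> A = B.
Proof.
move=> nsaA nsaB AB; apply/seteqP; split; first exact: form_ub_sub.
by apply: form_ub_sub => // f c; split=> /AB.
Qed.

Lemma closed_form_leP A B : nsa A -> nsa B ->
  closed_form_le ip A B <-> forall f c, form_ub ip B f c -> form_ub ip A f c.
Proof.
move=> nsaA nsaB; split=> [[domBA leAB] f c fc|h].
  have Bf : closed_form_dom ip B f by apply/(closed_form_domP ip_norm) => //; exists c.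
  have [b bE hb] := closed_formP ip_norm nsaB Bf.
  have [a aE ha] := closed_formP ip_norm nsaA (domBA _ Bf).
  have := leAB _ Bf; rewrite aE bE lecR => ab.
  by apply/ha; apply: le_trans ab _; apply/hb.
have dom : closed_form_dom ip B `<=` closed_form_dom ip A.
  move=> f /(closed_form_domP ip_norm nsaB)[c fc].
  by apply/(closed_form_domP ip_norm nsaA); exists c; exact: h.
split=> // f Bf.
have [b bE hb] := closed_formP ip_norm nsaB Bf.
have [a aE ha] := closed_formP ip_norm nsaA (dom _ Bf).
by rewrite aE bE lecR; apply/ha/h/hb.
Qed.

(** Existence comes from [T^* T] for the column [T f = (A^(1/2) f, B^(1/2) f)]; only then does the
    default-valued choice in [form_sum] acquire its defining properties. *)
Lemma form_sumP A B : nsa A -> nsa B -> nsa (form_sum ip A B) /\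
  forall f c, form_ub ip (form_sum ip A B) f c <->
    exists a b, [/\ form_ub ip A f a, form_ub ip B f b & a + b <= c].
Proof.
move=> nsaA nsaB.
pose D := closed_form_dom ip A `&` closed_form_dom ip B.
pose P C := [/\ nsa C, closed_form_dom ip C = D &
  forall f, D f -> closed_form ip C f = closed_form ip A f + closed_form ip B f].
have exP : exists C, P C.
  pose T : set (H * (H * H)) := [set t | sqrt_operator_part ip A (t.1, t.2.1) /\
    sqrt_operator_part ip B (t.1, t.2.2)].
  have sA := sqrt_submod ip_norm nsaA; have sB := sqrt_submod ip_norm nsaB.
  have sT : submod_closed [in T].
    have /submod_closedE[A0 AD] := sA; have /submod_closedE[B0 BD] := sB.
    apply/submod_closedE; split=> // a u v [uA uB] [vA vB].
    by split; [exact: AD uA vA|exact: BD uB vB].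
  have cT : complete_for (prod_hform (rform ip) sq2) T.
    move=> s Ts cs.
    have [c1 /cauchy_for_prod[c2 c3]] := cauchy_for_prod cs.
    have cprod (u v : nat -> H) : cauchy_for (rform ip) u -> cauchy_for (rform ip) v ->
        cauchy_for sq2 (fun n => (u n, v n)).
      move=> cu cv e e0; have e2 : 0 < e / 2 by rewrite divr_gt0.
      have [N hN] := cu _ e2; have [M hM] := cv _ e2.
      exists (maxn N M) => m n; rewrite !geq_max => /andP[m1 m2] /andP[n1 n2].
      by rewrite sqd_prod [ltRHS](splitr e) ltrD ?hN ?hM.
    have projs (u : nat -> H * H) w : tends_to sq2 u w ->
        tends_to (rform ip) (fun n => (u n).1) w.1 /\
        tends_to (rform ip) (fun n => (u n).2) w.2.
      move=> t; split=> e /t[N hN]; exists N => n /hN; rewrite sqd_prod;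
        by apply: le_lt_trans; rewrite ?lerDl ?lerDr sqd_ge0.
    have [w1 Aw1 /projs[/= t1 t1']] := sqrt_complete ip_norm nsaA
      (fun n => (Ts n).1) (cprod _ _ c1 c2).
    have [w2 Bw2 /projs[/= t2 t2']] := sqrt_complete ip_norm nsaB
      (fun n => (Ts n).2) (cprod _ _ c1 c3).
    (* Both graphs produce a limit of the same first components, so the two limits share their
       argument. *)
    have /(@rp_eq0 _ _ ip)/subr0_eq w12 := tends_to_unique t2 t1.
    exists (w1.1, (w1.2, w2.2)).
      by split; rewrite /= -?surjective_pairing// -w12 -surjective_pairing.
    by apply: tends_to_prod => //; exact: tends_to_prod.
  pose C := form_relation ip sq2 T.
  have nsaC : nsa C := form_relation_nsa ip_norm sT cT.
  have ubC f c : form_ub ip C f c <->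
      exists a b, [/\ form_ub ip A f a, form_ub ip B f b & a + b <= c].
    split=> [/(form_ub_relation ip_norm sT cT)[g [/= Ag Bg] gc]|].
      exists (rr g.1 g.1), (rr g.2 g.2); split=> //.
      - by apply/(form_ub_sqrt ip_norm nsaA); exists g.1.
      - by apply/(form_ub_sqrt ip_norm nsaB); exists g.2.
    move=> [a [b [/(form_ub_sqrt ip_norm nsaA)[g1 Ag1 g1a]
      /(form_ub_sqrt ip_norm nsaB)[g2 Bg2 g2b] abc]]].
    apply/(form_ub_relation ip_norm sT cT); exists (g1, g2) => //.
    by apply: le_trans abc; exact: lerD.
  have domC : closed_form_dom ip C = D.
    apply/seteqP; split=> f.
      move=> /(closed_form_domP ip_norm nsaC)[c /ubC[a [b [fa fb _]]]].
      by split; [apply/(closed_form_domP ip_norm nsaA); exists a|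
        apply/(closed_form_domP ip_norm nsaB); exists b].
    move=> [/(closed_form_domP ip_norm nsaA)[a fa] /(closed_form_domP ip_norm nsaB)[b fb]].
    by apply/(closed_form_domP ip_norm nsaC); exists (a + b); apply/ubC; exists a, b.
  exists C; split=> // f Df; have Cf : closed_form_dom ip C f by rewrite domC.
  have [c -> hc] := closed_formP ip_norm nsaC Cf.
  have [a -> ha] := closed_formP ip_norm nsaA Df.1.
  have [b -> hb] := closed_formP ip_norm nsaB Df.2.
  rewrite -rmorphD; congr (_%:C)%C; apply: le_anti; apply/andP; split.
    by apply/hc/ubC; exists a, b; split; [exact/ha|exact/hb|].
  have /ubC[a' [b' [/ha a1 /hb b1 /(le_trans _)]]] := (hc c).2 (lexx c).
  by apply; exact: lerD.
have [nsaF domF eqF] : P (form_sum ip A B) := @xgetPex _ set0 [set C | P C] exP.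
split=> // f c; split=> [fc|[a' [b' [fa fb abc]]]].
  have Ff : closed_form_dom ip (form_sum ip A B) f.
    by apply/(closed_form_domP ip_norm nsaF); exists c.
  have Df : D f by rewrite -domF.
  have [v vE hv] := closed_formP ip_norm nsaF Ff.
  have [a aE ha] := closed_formP ip_norm nsaA Df.1.
  have [b bE hb] := closed_formP ip_norm nsaB Df.2.
  exists a, b; split; [exact/ha|exact/hb|].
  by move: (eqF _ Df); rewrite vE aE bE -rmorphD => -[<-]; exact/hv.
have Df : D f.
  by split; [apply/(closed_form_domP ip_norm nsaA); exists a'|
    apply/(closed_form_domP ip_norm nsaB); exists b'].
have Ff : closed_form_dom ip (form_sum ip A B) f by rewrite domF.
have [v vE hv] := closed_formP ip_norm nsaF Ff.
have [a aE ha] := closed_formP ip_norm nsaA Df.1.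
have [b bE hb] := closed_formP ip_norm nsaB Df.2.
apply/hv; move: (eqF _ Df); rewrite vE aE bE -rmorphD => -[->].
by apply: le_trans abc; apply: lerD; [exact/ha|exact/hb].
Qed.

Lemma form_sum_nsa A B : nsa A -> nsa B -> nsa (form_sum ip A B).
Proof. by move=> nsaA /(form_sumP nsaA)[]. Qed.

Lemma form_ub_sum A B f c : nsa A -> nsa B ->
  form_ub ip (form_sum ip A B) f c <->
    exists a b, [/\ form_ub ip A f a, form_ub ip B f b & a + b <= c].
Proof. by move=> nsaA /(form_sumP nsaA)[_]; exact. Qed.

Lemma form_sumC A B : nsa A -> nsa B -> form_sum ip A B = form_sum ip B A.
Proof.
move=> nsaA nsaB; apply: form_ub_inj; [exact: form_sum_nsa|exact: form_sum_nsa|].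
move=> f c; split=> /form_ub_sum -/(_ _ _)[]// a [b [fa fb ab]];
  by apply/form_ub_sum => //; exists b, a; rewrite addrC.
Qed.

Lemma form_sumA A B C : nsa A -> nsa B -> nsa C ->
  form_sum ip A (form_sum ip B C) = form_sum ip (form_sum ip A B) C.
Proof.
move=> nsaA nsaB nsaC.
have nsaAB := form_sum_nsa nsaA nsaB; have nsaBC := form_sum_nsa nsaB nsaC.
apply: form_ub_inj; [exact: form_sum_nsa|exact: form_sum_nsa|] => f d; split.
  move=> /(form_ub_sum _ _ nsaA nsaBC)[a [e [fa /(form_ub_sum _ _ nsaB nsaC)]]].
  move=> [b [c [fb fc bc]]] ae; apply/form_ub_sum => //; exists (a + b), c.
  split=> //; last by lra.
  by apply/form_ub_sum => //; exists a, b.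
move=> /(form_ub_sum _ _ nsaAB nsaC)[e [c [/(form_ub_sum _ _ nsaA nsaB)]]].
move=> [a [b [fa fb ab]]] fc ec; apply/form_ub_sum => //; exists a, (b + c).
split=> //; last by lra.
by apply/form_ub_sum => //; exists b, c.
Qed.

(* Inversion reverses the order: [A^-1[f]] is the Legendre transform of [A]. *)
Lemma form_ub_inverse X Y : nsa X -> nsa Y ->
  (forall f c, form_ub ip Y f c -> form_ub ip X f c) ->
  forall f c, form_ub ip (lr_inverse X) f c -> form_ub ip (lr_inverse Y) f c.
Proof.
move=> nsaX nsaY YX f c fc [g' g] Yq /=.
have /= := YX _ _ (form_ub_mem nsaY Yq) => ubX.
rewrite -subr_le0; apply: (@le_of_small _ _ (rr f f + 1)) => t t0.
have [p [Xp pc gp]] := resolvent_approx ip_norm nsaX ubX (exprn_gt0 2 t0).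
have := fc (p.2, p.1); rewrite /lr_inverse /= -surjective_pairing => /(_ Xp) h.
have := hf_ge0 (rform ip) (t%:C%C *: f - (g - p.1)).
move: gp; rewrite /sqd.
have -> : rr f g = rr f p.1 + rr f (g - p.1) by rewrite -hfDr addrC subrK.
rewrite !(hfDl _ (t%:C%C *: f)) !(hfDr _ (t%:C%C *: f)).
move: (g - p.1) => d; rewrite !hfE (hfC _ d f) => h1 h2.
rewrite (hfC _ p.2) in pc; rewrite (hfC _ g') in pc *.
have := mulr_ge0 (ltW t0) (_ : 0 <= c - (2 * rr f p.1 - rr p.1 p.2)).
rewrite subr_ge0 => /(_ h).
have := mulr_ge0 (ltW t0) (_ : 0 <= rr g g' - rr p.1 p.2).
rewrite subr_ge0 => /(_ pc) k1 k2.
by rewrite -(ler_pM2l t0); lra.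
Qed.

(** The form domain of the inverse of [X] contains [ran X] and, by resolvent approximation, lies in
    its closure. *)
Lemma ran_subP X L : nsa X -> closed_subspace L ->
  lr_ran X `<=` L <-> forall f c, form_ub ip (lr_inverse X) f c -> L f.
Proof.
move=> nsaX [_ /(closed_sqd ip_norm) cL]; have nsaX' := nsa_inverse ip_norm nsaX.
split=> [ranX f c fc|hL f' [f Xf]].
  apply: cL => e e0; have [p [Xp _ fp]] := resolvent_approx ip_norm nsaX' fc e0.
  by exists p.1 => //; apply: ranX; exists p.2.
exact: (hL _ _ (form_ub_mem nsaX' (p := (f', f)) Xf)).
Qed.

(** For closed [L], the relation whose resolvent at 1 is the orthogonal projection onto [L]. *)
Definition zero_form_relation L : set (H * H) :=
  [set p | L p.1 /\ orthocompl ip L p.2].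

Lemma zero_form_relation_nsa L :
  closed_subspace L -> nsa (zero_form_relation L).
Proof.
move=> [sL cL]; have sL' := submod_orthocompl ip sL.
have orth p q : L p -> orthocompl ip L q -> rr q p = 0.
  by move=> Lp /(orthocompl_rr _ _ sL); exact.
apply: nsa_intro => //.
- have /submod_closedE[L0 LD] := sL; have /submod_closedE[K0 KD] := sL'.
  apply/submod_closedE; split=> // a u v [u1 u2] [v1 v2].
  by split; [exact: LD|exact: KD].
- by move=> p q [p1 p2] [q1 q2]; rewrite orth// hfC orth.
- by move=> p [p1 p2]; rewrite orth.
- move=> h; have cL' := (closed_sqd ip_norm L).1 cL.
  have [m [k [Lm Kk ->]]] := orthogonal_decomposition ip_norm h sL cL'.
  by exists (m, k).
Qed.

Lemma form_ub_zero L f c : closed_subspace L ->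
  form_ub ip (zero_form_relation L) f c <-> L f /\ 0 <= c.
Proof.
move=> clL; have nsaN := zero_form_relation_nsa clL; case: (clL) => sL cL.
split=> [fc|[Lf c0] p [p1 /(orthocompl_rr _ _ sL) p2]].
  split; last exact: form_ub_ge0 nsaN fc.
  apply: ((closed_sqd ip_norm L).1 cL) => e e0.
  by have [p [[Lp _] _ fp]] := resolvent_approx ip_norm nsaN fc e0; exists p.1.
by rewrite hfC !p2// mulr0 subr0.
Qed.

Lemma form_sum_zero_idem L : closed_subspace L ->
  form_sum ip (zero_form_relation L) (zero_form_relation L) = zero_form_relation L.
Proof.
move=> clL; have nsaN := zero_form_relation_nsa clL.
apply: form_ub_inj => //; first exact: form_sum_nsa.
move=> f c; split.
  move=> /form_ub_sum -/(_ nsaN nsaN)[a [b [/(form_ub_zero _ _ clL)[Lf a0]]]].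
  move=> /(form_ub_zero _ _ clL)[_ b0] abc; apply/form_ub_zero => //.
  by split=> //; lra.
move=> fc; have [Lf c0] := (form_ub_zero _ _ clL).1 fc.
apply/form_ub_sum => //; exists 0, c; rewrite add0r; split=> //.
by apply/form_ub_zero.
Qed.

(** After inversion, a candidate is a relation whose form lies above that of [A^-1] and has its
    domain in [L]; adding the zero form on [L] gives the smallest such form. *)
Lemma shortedE A L : nsa A -> closed_subspace L ->
  shorted ip A L = lr_inverse (form_sum ip (lr_inverse A) (zero_form_relation L)).
Proof.
move=> nsaA clL; set M0 := lr_inverse _.
have nsaN := zero_form_relation_nsa clL.
have nsaA' := nsa_inverse ip_norm nsaA.
have nsaF := form_sum_nsa nsaA' nsaN.
have nsaM0 : nsa M0 := nsa_inverse ip_norm nsaF.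
have cand : shorted_candidate ip A L M0.
  split=> //.
    apply/closed_form_leP => // f c; rewrite -{1}(lr_inverseK A).
    apply: form_ub_inverse => // g d /form_ub_sum -/(_ nsaA' nsaN)[a [b [ga]]].
    by move=> /(form_ub_zero _ _ clL)[_ b0] ab; apply: form_ub_le ga _; lra.
  apply/ran_subP => // f c; rewrite lr_inverseK.
  by move=> /form_ub_sum -/(_ nsaA' nsaN)[a [b [_ /(form_ub_zero _ _ clL)[]]]].
(* [M0] is shown to be the greatest candidate, hence the only maximal one, which is what the choice
   in [shorted] needs. *)
have top X : shorted_candidate ip A L X -> closed_form_le ip X M0.
  move=> [nsaX XA ranX]; have nsaX' := nsa_inverse ip_norm nsaX.
  apply/closed_form_leP => // f c; rewrite -(lr_inverseK X).
  apply: form_ub_inverse => // {}f {}c fc.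
  apply/form_ub_sum => //; exists c, 0; rewrite addr0; split=> //.
    by apply: (form_ub_inverse nsaX nsaA) fc; exact/closed_form_leP.
  by apply/form_ub_zero => //; split=> //; exact: (ran_subP nsaX clL).1 ranX _ _ fc.
have anti X : nsa X -> closed_form_le ip X M0 -> closed_form_le ip M0 X -> X = M0.
  move=> nsaX /(closed_form_leP nsaX nsaM0) h1 /(closed_form_leP nsaM0 nsaX) h2.
  by apply: form_ub_inj => // f c; split; [exact: h2|exact: h1].
apply: xget_unique.
  by split=> // X candX le0X; apply: anti => //; [case: candX|exact: top].
by move=> M [candM maxM]; rewrite (maxM M0)//; exact: top.
Qed.

End FormSum.

Theorem corollary4p4 (R : realType) (H : completeNormedModType R[i])
  (ip : inner_product H) (ip_norm : induces_norm ip)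
  (A B : set (H * H)) (L : set H)
  (nsaA : nonneg_selfadjoint ip A) (nsaB : nonneg_selfadjoint ip B)
  (clL : closed_subspace L) :
  [/\ shorted ip (parallel_sum ip A B) L = parallel_sum ip (shorted ip A L) B,
      parallel_sum ip (shorted ip A L) B = parallel_sum ip A (shorted ip B L) &
      parallel_sum ip A (shorted ip B L) =
        parallel_sum ip (shorted ip A L) (shorted ip B L)].
Proof.
have nsaN := zero_form_relation_nsa ip_norm clL.
have nsaA' := nsa_inverse ip_norm nsaA; have nsaB' := nsa_inverse ip_norm nsaB.
have nsaAN := form_sum_nsa ip_norm nsaA' nsaN.
have nsaBN := form_sum_nsa ip_norm nsaB' nsaN.
have nsaAB := form_sum_nsa ip_norm nsaA' nsaB'.
have nsaP := nsa_inverse ip_norm nsaAB.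
rewrite (shortedE ip_norm nsaA clL) (shortedE ip_norm nsaB clL).
rewrite (shortedE ip_norm nsaP clL) /parallel_sum !lr_inverseK.
set N := zero_form_relation ip L in nsaN nsaAN nsaBN *.
set A' := lr_inverse A in nsaA' nsaAN nsaAB *.
set B' := lr_inverse B in nsaB' nsaBN nsaAB *.
(* All four members are now inverses of form sums of [A'], [B'] and [N], differing in order,
   grouping and the number of copies of [N]. *)
have swap : form_sum ip (form_sum ip A' N) B' = form_sum ip A' (form_sum ip B' N).
  by rewrite (form_sumC ip_norm nsaB' nsaN) form_sumA.
split; congr lr_inverse.
- by rewrite swap form_sumA.
- exact: swap.
(* The second copy of [N] is brought next to the first and absorbed by idempotence. *)
- rewrite -(form_sumA ip_norm nsaA' nsaN nsaBN) (form_sumC ip_norm nsaN nsaBN).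
  by rewrite -(form_sumA ip_norm nsaB' nsaN nsaN) form_sum_zero_idem.
Qed.
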